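(* Let $d\ge2$ be an integer, $\mu\ge 0$, $\lambda\ge0$, and consider the particle system on the random graph $G$ described in the context, with $\pi$ the Poisson distribution with mean $\lambda$. Let $n\ge1$ and $\mathbf a=(a_{y,i})_{1\le y\le n,\,1\le i\le d-1}\in\{0,1\}^{(d-1)n}$. Let $A^{\mathbf a}$ be the event that all the vertices $v_{y,i}$ with $a_{y,i}=1$ get activated in the variant of the system in which there are no sleeping particles at the vertices $v_{x,j}$ with $a_{x,j}=0$ (i.e. $W_{x,j}$ is replaced by $0$ for such $x,j$). Let $A=(A_{y,i})$. Then $$\mathbf P(A=\mathbf a\mid N=n)=\exp\Bigl(-\sum_{x,j}(1-a_{x,j})\Bigl[\tfrac{\mu}{d+1}d^{\,x-n}+\lambda d^{\,x-n-1}+\lambda\sum_{y,i}a_{y,i}d^{-|y-x|-1}\Bigr]\Bigr)\,\mathbf P(A^{\mathbf a}\mid N=n),$$ where the sums are over all $(x,j)$ and $(y,i)$ in $\{1,\ldots,n\}\times\{1,\ldots,d-1\}$.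
   Context: Let $\tau$ be a probability measure on $\{1,2,\ldots\}\cup\{\infty\}$ with $\tau(\{\infty\})<1$, let $T\sim\tau$, and set $\alpha=\mathbf E[(d+1)^{-T+1}]$ (with $(d+1)^{-\infty}=0$). Let $\pi$ be a probability measure on the nonnegative integers. The particle system is as follows. Let $N$ be geometric with parameter $\alpha$ on $\{1,2,\ldots\}$. Take a path with $N+2$ vertices, whose first vertex is called $\varnothing$ and whose last two vertices are called $v$ and $v'$ (in this order). Label the vertices after $\varnothing$ up to and including $v$ in order as $1,2,\ldots,N$ (so $v$ is vertex $N$). The graph $G$ is obtained by attaching to each $y\in\{1,\ldots,N\}$ leaves $v_{y,1},\ldots,v_{y,d-1}$. Place $X_v\sim\mathrm{Poi}(\mu)$ particles at $v$, a $\pi$-distributed number of particles at $v'$, and $W_{y,i}\sim\pi$ particles at each $v_{y,i}$, all these numbers being independent of each other and (given $N$) of the walks. Other vertices start with no particles. Initially only the particles at $v$ and $v'$ are active, and those at the $v_{y,i}$ are sleeping. Active particles perform independent non-backtracking random walks on $G$: the first step is to a uniformly random neighbor of the starting vertex, and each later step is to a uniformly random neighbor other than the vertex just left. When an active particle reaches a leaf of $G$ distinct from its starting location, it halts there. When an active particle moves to a vertex containing sleeping particles, all particles there become active. $A_{y,i}$ is the indicator of the event that $v_{y,i}$ is eventually activated, i.e. that some active particle moves to $v_{y,i}$. *)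

(* Defs.v *)
From HB Require Import structures.
From mathcomp Require Import all_boot all_order all_algebra.
From mathcomp Require Import all_classical all_reals all_analysis.

Set Implicit Arguments.
Unset Strict Implicit.
Unset Printing Implicit Defensive.

Import Order.TTheory GRing.Theory Num.Theory.

Local Open Scope classical_set_scope.
Local Open Scope ring_scope.

(* {0, 1, 2, ...} U {oo}, with the discrete sigma-algebra; None is oo. *)
Definition ext_nat := option nat.

HB.instance Definition _ := Pointed.on ext_nat.
HB.instance Definition _ := @isMeasurable.Build default_measure_display
  ext_nat discrete_measurable discrete_measurable0
  discrete_measurableC discrete_measurableU.

(* E[(d+1)^(-T+1)] for T of law tau *)
Definition alpha (R : realType) (d : nat) (tau : probability ext_nat R) : R :=
  fine 'E_tau[fun t : ext_nat =>
    if t is Some k then d.+1%:R ^ (1 - k%:Z) else 0 : R].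

(* [spine k] is the k-th vertex of the path: [spine 0] is the root, and in the
   graph with N = n the vertices v and v' are [spine n] and [spine n.+1].
   [leaf y i] is v_{y,i+1} (i ranges over {0, ..., d-2}). One type holds the
   vertices of the graphs for all values of N; see [vertices] below. *)
Inductive vertex (d : nat) : Type :=
| spine of nat
| leaf of nat & 'I_d.-1.

Arguments spine {d} _.

Section vertex_instances.
Variable d : nat.

Definition vertex_code (u : vertex d) : nat + nat * 'I_d.-1 :=
  match u with spine k => inl k | leaf y i => inr (y, i) end.

Definition vertex_decode (c : nat + nat * 'I_d.-1) : vertex d :=
  match c with inl k => spine k | inr (y, i) => leaf y i end.

Lemma vertex_codeK : cancel vertex_code vertex_decode.
Proof. by case. Qed.

HB.instance Definition _ := Countable.copy (vertex d) (can_type vertex_codeK).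
HB.instance Definition _ := isPointed.Build (vertex d) (spine 0).
HB.instance Definition _ := @isMeasurable.Build default_measure_display
  (vertex d) discrete_measurable discrete_measurable0
  discrete_measurableC discrete_measurableU.
End vertex_instances.

Section graph.
Variable d : nat.

Definition vertices (n : nat) : seq (vertex d) :=
  [seq spine k | k <- iota 0 n.+2] ++
  [seq leaf y i | y <- iota 1 n, i <- enum 'I_d.-1].

Definition adj (u w : vertex d) : bool :=
  match u, w with
  | spine k, spine l => (k.+1 == l) || (l.+1 == k)
  | spine k, leaf y _ => k == y
  | leaf y _, spine k => k == y
  | leaf _ _, leaf _ _ => false
  end.

Definition neighbors (n : nat) (u : vertex d) : seq (vertex d) :=
  [seq w <- vertices n | adj u w].

Definition is_leaf (n : nat) (u : vertex d) : bool :=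
  size (neighbors n u) == 1%N.

End graph.

Section walk_law.
Variables (R : realType) (d : nat).

Definition uniform_pmf (l : seq (vertex d)) (x : vertex d) : R :=
  (x \in l)%:R / (size l)%:R.

(* Probability that the walk started at s on the graph with N = n, being at cur
   after having just left p (prev = Some p) or being about to make its first
   step (prev = None), is next at x. A halted walk stays where it is. *)
Definition nb_step (n : nat) (s : vertex d) (prev : option (vertex d))
    (cur x : vertex d) : R :=
  match prev with
  | None => uniform_pmf (neighbors n cur) x
  | Some p =>
      if is_leaf n cur && (cur != s) then (x == cur)%:R
      else uniform_pmf [seq w <- neighbors n cur | w != p] x
  end.

Fixpoint nb_path_prob (n : nat) (s : vertex d) (prev : option (vertex d))
    (cur : vertex d) (xs : seq (vertex d)) : R :=
  match xs with
  | [::] => 1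
  | x :: xs' =>
      nb_step n s prev cur x * nb_path_prob n s (Some cur) x xs'
  end.

End walk_law.

Section activation.
Variables (d N : nat) (count : vertex d -> nat)
          (walk : vertex d -> nat -> nat -> vertex d).

(* The particles starting at u are numbered 0, ..., count u - 1, and
   [walk u k m] is the position of the k-th one after m steps of its own.
   [active u]: the particles starting at u are active from the beginning or
   become so at some time. *)
Inductive active : vertex d -> Prop :=
| active_v : active (spine N)
| active_v' : active (spine N.+1)
| active_wake s k m : active s -> (k < count s)%N -> active (walk s k m.+1).

Definition activated (u : vertex d) : Prop :=
  exists s k m, [/\ active s, (k < count s)%N & walk s k m.+1 = u].

End activation.

Section probability_notions.
Variables (disp : measure_display) (Omega : measurableType disp).
Variables (R : realType) (P : probability Omega R).

(* P(E | F), with value 0 when P(F) = 0 *)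
Definition cprob (E F : set Omega) : R :=
  fine (P (E `&` F)) / fine (P F).

Definition mutually_independent (Q : set Omega -> R) (I : Type) (D : set I)
    (F : I -> set (set Omega)) : Prop :=
  forall (m : nat) (s : 'I_m -> I) (E : 'I_m -> set Omega),
    injective s -> (forall k, D (s k) /\ F (s k) (E k)) ->
    Q [set w | forall k, E k w] = \prod_(k < m) Q (E k).

End probability_notions.

Section system.
Variables (disp : measure_display) (Omega : measurableType disp).
Variables (R : realType) (P : probability Omega R) (d : nat).

(* Every starting location carries an infinite supply of walks, the k-th of
   which is used by the k-th particle there, if there is one. *)
Record particle_system := ParticleSystem {
  ps_N : {RV P >-> nat};
  ps_X : {RV P >-> nat};   (* number of particles at v *)
  ps_X' : {RV P >-> nat};  (* number of particles at v' *)
  ps_W : nat -> 'I_d.-1 -> {RV P >-> nat};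
  ps_walk : vertex d -> nat -> nat -> {RV P >-> vertex d}
}.

Inductive source : Type :=
| src_X
| src_X'
| src_W of nat & 'I_d.-1
| src_walk of vertex d & nat.

Definition starts (n : nat) (u : vertex d) : bool :=
  match u with
  | spine k => (k == n) || (k == n.+1)
  | leaf y _ => (1 <= y <= n)%N
  end.

Definition present (n : nat) : set source :=
  [set r | match r with
           | src_X | src_X' => True
           | src_W y _ => (1 <= y <= n)%N
           | src_walk u _ => starts n u
           end].

Definition source_events (S : particle_system) (r : source) :
    set (set Omega) :=
  match r with
  | src_X => preimage_set_system setT (ps_X S) measurable
  | src_X' => preimage_set_system setT (ps_X' S) measurable
  | src_W y i => preimage_set_system setT (ps_W S y i) measurable
  | src_walk u k =>
      <<s \bigcup_m preimage_set_system setT (ps_walk S u k m) measurable >>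
  end.

Definition N_is (S : particle_system) (n : nat) : set Omega :=
  [set w | ps_N S w = n].

(* The second argument of poisson_prob is not used by its definition;
   poisson_prob 0 is the Dirac measure at 0. Conditionally on N = n, the sources
   of randomness that exist in the graph are mutually independent, each with its
   law. *)
Record is_particle_system (al mu : R) (pi : probability nat R)
    (S : particle_system) : Prop := IsParticleSystem {
  N_geometric : forall n : nat,
    P (N_is S n.+1) = (al * (1 - al) ^+ n)%:E;
  X_law : forall n : nat, (0 < P (N_is S n))%E -> forall B : set nat,
    cprob P (ps_X S @^-1` B) (N_is S n) = fine (poisson_prob mu 0%N B);
  X'_law : forall n : nat, (0 < P (N_is S n))%E -> forall B : set nat,
    cprob P (ps_X' S @^-1` B) (N_is S n) = fine (pi B);
  W_law : forall n : nat, (0 < P (N_is S n))%E ->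
    forall (y : nat) (i : 'I_d.-1), (1 <= y <= n)%N -> forall B : set nat,
    cprob P (ps_W S y i @^-1` B) (N_is S n) = fine (pi B);
  walk_law : forall n : nat, (0 < P (N_is S n))%E ->
    forall (u : vertex d) (k : nat), starts n u ->
    forall xs : seq (vertex d),
    cprob P [set w | ps_walk S u k 0%N w = u /\
                     forall m : nat, (m < size xs)%N ->
                       ps_walk S u k m.+1 w = nth u xs m] (N_is S n)
      = nb_path_prob R n u None u xs;
  sources_independent : forall n : nat, (0 < P (N_is S n))%E ->
    mutually_independent (fun E => cprob P E (N_is S n)) (present n)
      (source_events S)
}.

Definition ps_count (S : particle_system) (w : Omega) (u : vertex d) : nat :=
  match u with
  | spine k => if k == ps_N S w then ps_X S w
               else if k == (ps_N S w).+1 then ps_X' S w else 0%N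
  | leaf y i => if (1 <= y <= ps_N S w)%N then ps_W S y i w else 0%N
  end.

(* A_{y,i} *)
Definition leaf_activated (S : particle_system) (y : nat) (i : 'I_d.-1)
    (w : Omega) : bool :=
  `[< activated (ps_N S w) (ps_count S w) (fun u k m => ps_walk S u k m w)
        (leaf y i) >].

Definition thin (a : nat -> 'I_d.-1 -> bool) (count : vertex d -> nat)
    (u : vertex d) : nat :=
  match u with
  | spine _ => count u
  | leaf x j => if a x j then count u else 0%N
  end.

(* In the next two events only the entries a y i with 1 <= y <= n matter when
   N = n: such an a stands for an element of {0,1}^((d-1)n). *)
Definition A_eq (S : particle_system) (n : nat)
    (a : nat -> 'I_d.-1 -> bool) : set Omega :=
  [set w | forall (y : nat) (i : 'I_d.-1), (1 <= y <= n)%N ->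
             leaf_activated S y i w = a y i].

Definition A_event (S : particle_system) (n : nat)
    (a : nat -> 'I_d.-1 -> bool) : set Omega :=
  [set w | forall (y : nat) (i : 'I_d.-1), (1 <= y <= n)%N -> a y i ->
             activated (ps_N S w) (thin a (ps_count S w))
               (fun u k m => ps_walk S u k m w) (leaf y i)].

End system.

(* Main.v *)
Require Import Defs.
From HB Require Import structures.
From mathcomp Require Import all_boot all_order all_algebra.
From mathcomp Require Import all_classical all_reals all_analysis.
From mathcomp Require Import ring zify.

(** Non-backtracking walks on a tree halt at the first leaf they meet, so almost
    surely a particle visits at most one of the vertices v_{y,i}, and all that
    matters about it is which one, if any.  Let the empty sites be the v_{x,j}
    with a_{x,j} = 0.  If A = a then no particle of an empty site ever moves, so
    the system coincides with the one whose empty sites hold no particles; in the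
    latter, A = a says that A^a occurs and that no particle of v, v' or a site
    with a_{y,i} = 1 ends at an empty site: on A^a all these particles do move
    ([activationP], [thinned_activationP]).  Moreover, a particle that ends at an
    empty site wakes nobody up, so A^a only depends on the other particles
    ([all_wanted_reached_filter]).

    The numbers of particles are Poisson.  By thinning, for every start, the
    particles that end at an empty site are independent of the others and their
    number is Poisson, of mean the rate of the start times the probability that a
    walk from there ends at an empty site.  Hence A^a is independent of the event
    that there is no such particle, and the latter has probability exp(-K) where K
    is the sum of those means ([joint_mean_thinning], [cprob_A_eq]).

    It remains to compute K.  In the tree rooted at the target leaf, a
    non-backtracking walk that once moves away from the root never comes back, so
    the only way to hit the leaf is to follow the geodesic, whose probability is
    one over the degree of the start times 1/d for every further step
    ([nb_path_route], [nb_path_prob_route]).  Summing over starts and empty sites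
    gives the exponent ([absorption_rateE]).

    On the measure-theoretic side, the lists of leaves hit by the particles of
    each start form a discrete random variable; independence gives the
    probabilities of its atoms ([atom_prob]), and up to a null event both A = a and
    A^a are unions of atoms ([hits_event_prob]). *)

Set Implicit Arguments.
Unset Strict Implicit.
Unset Printing Implicit Defensive.

Import Order.TTheory GRing.Theory Num.Theory.

Local Open Scope classical_set_scope.
Local Open Scope ring_scope.

(** * Thinning of compound Poisson lists *)

Section thinning.
Context {R : realType} {T : finType}.
Implicit Types (q : T -> R) (F : seq T -> \bar R) (u : pred T).
Local Open Scope ereal_scope.

(** The expectation of [F] over a list of [c] independent entries of law [q]. The
    recursion on the head replaces a sum over tuples, so that thinning is an
    induction on [c]. *)
Fixpoint iid_mean q (c : nat) F : \bar R :=
  if c is c'.+1 then \sum_(t : T) (q t)%:E * iid_mean q c' (fun l => F (t :: l))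
  else F [::].

Definition poisson_weight (r : R) (c : nat) : R :=
  (r ^+ c / c`!%:R * expR (- r))%R.

(** The expectation of [F] over a list of independent entries of law [q] whose
    length is Poisson of mean [r]. *)
Definition cp_mean (r : R) q F : \bar R :=
  \sum_(c <oo) (poisson_weight r c)%:E * iid_mean q c F.

Definition restrict_all u F : seq T -> \bar R :=
  fun l => if all u l then F l else 0.

Lemma poisson_weight_ge0 (r : R) c : (0 <= r)%R -> (0 <= poisson_weight r c)%R.
Proof.
by move=> r0; rewrite /poisson_weight mulr_ge0 ?expR_ge0// divr_ge0// exprn_ge0.
Qed.

Lemma eq_iid_mean q c F G :
  (forall l, size l = c -> F l = G l) -> iid_mean q c F = iid_mean q c G.
Proof.
elim: c F G => [|c IH] F G FG /=; first exact: FG.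
by apply: eq_bigr => t _; congr (_ * _); apply: IH => l lc; apply: FG; rewrite /= lc.
Qed.

Lemma iid_mean_ge0 q c F : (forall t, (0 <= q t)%R) -> (forall l, 0 <= F l) ->
  0 <= iid_mean q c F.
Proof.
move=> q0; elim: c F => [|c IH] F F0 /=; first exact: F0.
by apply: sume_ge0 => t _; rewrite mule_ge0 ?lee_fin//; apply: IH.
Qed.

Lemma iid_mean0 q c : iid_mean q c (fun=> 0) = 0.
Proof.
by elim: c => [//|c IH] /=; apply: big1 => t _; rewrite IH mule0.
Qed.

Lemma cp_mean_ge0 r q F : (0 <= r)%R -> (forall t, (0 <= q t)%R) ->
  (forall l, 0 <= F l) -> 0 <= cp_mean r q F.
Proof.
move=> r0 q0 F0; apply: nneseries_ge0 => c _ _.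
by rewrite mule_ge0 ?lee_fin ?poisson_weight_ge0// iid_mean_ge0.
Qed.

Lemma iid_mean_restrictS q c u F :
  iid_mean q c.+1 (restrict_all u F) =
  \sum_(t | u t) (q t)%:E * iid_mean q c (restrict_all u (fun l => F (t :: l))).
Proof.
rewrite /= [RHS]big_mkcond /=; apply: eq_bigr => t _.
rewrite /restrict_all /=; case: ifP => ut //=.
by rewrite (@eq_iid_mean q c _ (fun=> 0)) // iid_mean0 mule0.
Qed.

Lemma restrict_all_ge0 u F : (forall l, 0 <= F l) ->
  forall l, 0 <= restrict_all u F l.
Proof. by move=> F0 l; rewrite /restrict_all; case: ifP. Qed.

(** Sum over the positions of the entries that satisfy [u]. The others contribute
    their total mass each, and the law of the sublist that [F] sees depends on the
    number of its entries only, whence the binomial coefficient. The induction on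
    the head is Pascal's rule. *)
Lemma iid_mean_thinning q u F c : (forall t, (0 <= q t)%R) -> (forall l, 0 <= F l) ->
  iid_mean q c (fun l => F (seq.filter u l)) =
  \sum_(k < c.+1) ('C(c, k)%:R * (\sum_(t | ~~ u t) q t) ^+ (c - k))%:E *
                  iid_mean q k (restrict_all u F).
Proof.
move=> q0; set p := (\sum_(t | ~~ u t) q t)%R.
have p0 : (0 <= p)%R by apply: sumr_ge0.
elim: c F => [|c IH] F F0.
  by rewrite big_ord1 /= subnn bin0 expr0 mulr1 mul1e.
have G0 k G : (forall l, 0 <= G l) -> 0 <= iid_mean q k (restrict_all u G).
  by move=> G0; apply: iid_mean_ge0 => //; apply: restrict_all_ge0.
have b0 (k m : nat) : 0 <= ('C(c, k)%:R * p ^+ m)%:E :> \bar R.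
  by rewrite lee_fin mulr_ge0// exprn_ge0.
have marked :
    \sum_(t | ~~ u t) (q t)%:E * iid_mean q c (fun l => F (seq.filter u (t :: l))) =
    p%:E * iid_mean q c (fun l => F (seq.filter u l)).
  rewrite /p -sumEFin ge0_sume_distrl; last by move=> t _; rewrite lee_fin.
  by apply: eq_bigr => t /negbTE /= ->.
have unmarked :
    \sum_(t | u t) (q t)%:E * iid_mean q c (fun l => F (seq.filter u (t :: l))) =
    \sum_(k < c.+1) ('C(c, k)%:R * p ^+ (c - k))%:E *
                  iid_mean q k.+1 (restrict_all u F).
  transitivity (\sum_(t | u t) \sum_(k < c.+1) ('C(c, k)%:R * p ^+ (c - k))%:E *
      ((q t)%:E * iid_mean q k (restrict_all u (fun l => F (t :: l))))).
    apply: eq_bigr => t ut /=; rewrite ut (IH (fun l => F (t :: l)))//.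
    rewrite ge0_sume_distrr; last by move=> k _; rewrite mule_ge0// G0.
    by apply: eq_bigr => k _; rewrite muleCA.
  rewrite exchange_big /=; apply: eq_bigr => k _.
  rewrite -ge0_sume_distrr; last by move=> t _; rewrite mule_ge0 ?lee_fin// G0.
  by rewrite -iid_mean_restrictS.
transitivity (p%:E * iid_mean q c (fun l => F (seq.filter u l)) +
   \sum_(k < c.+1) ('C(c, k)%:R * p ^+ (c - k))%:E *
                  iid_mean q k.+1 (restrict_all u F)).
  rewrite -marked -unmarked addeC /=.
  by rewrite (bigID u) /=.
rewrite IH// ge0_sume_distrr; last by move=> k _; rewrite mule_ge0// G0.
rewrite big_ord_recl [RHS]big_ord_recl /= -addeA.
congr (_ + _).
  by rewrite muleA -EFinM !bin0 !mul1r !subn0 exprS.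
rewrite big_ord_recr [RHS]big_ord_recr /= addeA -big_split /=.
congr (_ + _); last by rewrite /bump /= add1n !binn !subnn.
apply: eq_bigr => k _; rewrite /bump /= add1n muleA -EFinM.
rewrite -ge0_muleDl ?lee_fin ?mulr_ge0 ?exprn_ge0//; congr (_%:E * _).
have e : (c - k = (c - k.+1).+1)%N by rewrite subnSK.
rewrite binS natrD subSS !e exprS; ring.
Qed.

(** Unlike [nneseriesZl], the factor may be infinite, so that no finiteness has to
    be carried along for the functionals that are averaged. *)
Lemma nneseriesZl_ge0 (x : \bar R) (f : nat -> \bar R) : 0 <= x ->
  (forall m, 0 <= f m) -> \sum_(m <oo) x * f m = x * \sum_(m <oo) f m.
Proof.
case: x => [x| |] // x0 f0; first by rewrite nneseriesZl.
have [f_eq0|] := pselect (forall m, f m = 0).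
  by rewrite !eseries0 ?mule0// => m _ _; rewrite f_eq0 ?mule0.
move=> /existsNP[m /eqP fm].
have fm0 : 0 < f m by rewrite lt0e fm f0.
have pos : 0 < \sum_(m <oo) f m.
  apply: (lt_le_trans fm0); rewrite (@nneseriesD1 _ _ m xpredT)//; apply: leeDl.
  by apply: nneseries_ge0.
rewrite gt0_mulye//; apply: (@nneseries_pinfty _ _ xpredT m) => //.
  by move=> i _; rewrite mule_ge0.
by rewrite gt0_mulye.
Qed.

(** Poisson splitting: in a Poisson number of points that are erased independently
    with probability [p], the number of kept points and the number of erased ones
    decouple. *)
Lemma poisson_weight_split r (p : R) k m :
  (poisson_weight r (k + m) * ('C(k + m, k)%:R * p ^+ m) =
   poisson_weight r k * ((r * p) ^+ m / m`!%:R))%R.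
Proof.
have fz (i : nat) : (i`!%:R != 0 :> R)%R by rewrite pnatr_eq0 -lt0n fact_gt0.
have := bin_fact (leq_addr m k); rewrite addKn => /(congr1 (fun i => i%:R : R)).
rewrite !natrM => h.
rewrite /poisson_weight exprMn exprD -h.
have cz : ('C(k + m, k)%:R != 0 :> R)%R.
  by rewrite pnatr_eq0 -lt0n bin_gt0 leq_addr.
by field; rewrite !fz cz.
Qed.

Lemma expR_eseries (x : R) : (0 <= x)%R ->
  \sum_(m <oo) (x ^+ m / m`!%:R)%:E = (expR x)%:E.
Proof.
move=> x0; rewrite expRE -EFin_lim; last first.
  rewrite /pseries/=; under eq_fun do rewrite mulrC.
  exact: is_cvg_series_exp_coeff.
apply/congr_lim/funext => n/=; rewrite /pseries/= /series/= -sumEFin//.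
by apply: eq_bigr => i _; rewrite mulrC.
Qed.

(** If [F] ignores the entries that fail [u], it is independent of the event that
    there are no such entries, whose probability is [exp (- r * P(~ u))]. *)
Lemma cp_mean_thinning r q u F : (0 <= r)%R -> (forall t, (0 <= q t)%R) ->
  (forall l, 0 <= F l) ->
  cp_mean r q (fun l => F (seq.filter u l)) =
  (expR (r * \sum_(t | ~~ u t) q t))%:E * cp_mean r q (restrict_all u F).
Proof.
move=> r0 q0 F0; set p := (\sum_(t | ~~ u t) q t)%R.
have p0 : (0 <= p)%R by apply: sumr_ge0.
have G0 k : 0 <= iid_mean q k (restrict_all u F).
  by apply: iid_mean_ge0 => //; apply: restrict_all_ge0.
(* the share of the lists of length [c] of which [k] entries are kept *)
pose a (c k : nat) : \bar R := if (k <= c)%N then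
  (poisson_weight r c * ('C(c, k)%:R * p ^+ (c - k)))%:E *
  iid_mean q k (restrict_all u F) else 0.
have a0 c k : 0 <= a c k.
  rewrite /a; case: ifP => // _; rewrite mule_ge0// lee_fin mulr_ge0//.
    exact: poisson_weight_ge0.
  by rewrite mulr_ge0// exprn_ge0.
transitivity (\sum_(c <oo) \sum_(k <oo) a c k).
  apply: eq_eseriesr => c _; rewrite iid_mean_thinning//.
  rewrite (nneseries_split 0%N c.+1)// add0n [X in _ + X]eseries0; last first.
    by move=> k ck _; rewrite /a leqNgt ck.
  rewrite adde0 big_mkord ge0_sume_distrr; last first.
    by move=> k _; rewrite mule_ge0// lee_fin mulr_ge0// exprn_ge0.
  by apply: eq_bigr => k _; rewrite /a -ltnS ltn_ord muleA -EFinM.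
(* fix the number [k] of kept entries and sum over that of erased ones *)
rewrite nneseries_interchange// /cp_mean -nneseriesZl; last first.
  by move=> k _; rewrite mule_ge0// lee_fin poisson_weight_ge0.
apply: eq_eseriesr => k _.
rewrite (nneseries_split 0%N k)// add0n big_mkord big1; last first.
  by move=> c _; rewrite /a leqNgt ltn_ord.
rewrite add0e -nneseries_addn//.
transitivity (\sum_(m <oo) iid_mean q k (restrict_all u F) *
   ((poisson_weight r k)%:E * ((r * p) ^+ m / m`!%:R)%:E)).
  apply: eq_eseriesr => m _; rewrite /a addnC leq_addr addKn.
  by rewrite poisson_weight_split EFinM muleC.
have e0 m : 0 <= ((r * p) ^+ m / m`!%:R)%:E.
  by rewrite lee_fin divr_ge0// exprn_ge0// mulr_ge0.
rewrite nneseriesZl_ge0//; last first.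
  by move=> m; rewrite mule_ge0// lee_fin poisson_weight_ge0.
rewrite nneseriesZl// (expR_eseries (mulr_ge0 r0 p0)).
by rewrite [LHS]muleC -[LHS]muleA [LHS]muleCA.
Qed.
End thinning.

Section nested.
Context {R : realType} {T : finType} {I : Type}.
Variables (r : I -> R) (q : I -> T -> R).
Hypotheses (r0 : forall s, 0 <= r s) (q0 : forall s t, 0 <= q s t).
Local Open Scope ereal_scope.

(** The expectation of [F] over independent compound Poisson lists, one for every
    index in [ss]. *)
Fixpoint joint_mean (ss : seq I) (F : seq (seq T) -> \bar R) : \bar R :=
  if ss is s :: ss' then
    cp_mean (r s) (q s) (fun l => joint_mean ss' (fun ls => F (l :: ls)))
  else F [::].

Lemma eq_cp_mean x p (F G : seq T -> \bar R) :
  F =1 G -> cp_mean x p F = cp_mean x p G.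
Proof. by move=> /funext ->. Qed.

Lemma eq_joint_mean ss F G : F =1 G -> joint_mean ss F = joint_mean ss G.
Proof. by move=> /funext ->. Qed.

Lemma cp_mean0 x (p : T -> R) : cp_mean x p (fun=> 0) = 0.
Proof. by apply: eseries0 => c _ _; rewrite iid_mean0 mule0. Qed.

Lemma joint_mean0 ss : joint_mean ss (fun=> 0) = 0.
Proof.
by elim: ss => //= s ss IH; rewrite (@eq_cp_mean _ _ _ (fun=> 0)) ?cp_mean0.
Qed.

Lemma joint_mean_ge0 ss F : (forall ls, 0 <= F ls) -> 0 <= joint_mean ss F.
Proof.
elim: ss F => [|s ss IH] F F0 /=; first exact: F0.
by apply: cp_mean_ge0 => // l; apply: IH.
Qed.

Lemma iid_meanZ (p : T -> R) c (k : R) (F : seq T -> \bar R) :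
  (0 <= k)%R -> (forall t, (0 <= p t)%R) -> (forall l, 0 <= F l) ->
  iid_mean p c (fun l => k%:E * F l) = k%:E * iid_mean p c F.
Proof.
move=> k0 p0; elim: c F => [//|c IH] F F0 /=.
rewrite ge0_sume_distrr; last first.
  by move=> t _; rewrite mule_ge0 ?lee_fin//; apply: iid_mean_ge0.
by apply: eq_bigr => t _; rewrite IH// muleCA.
Qed.

Lemma cp_meanZ x (p : T -> R) (k : R) (F : seq T -> \bar R) :
  (0 <= x)%R -> (0 <= k)%R -> (forall t, (0 <= p t)%R) -> (forall l, 0 <= F l) ->
  cp_mean x p (fun l => k%:E * F l) = k%:E * cp_mean x p F.
Proof.
move=> x0 k0 p0 F0; rewrite /cp_mean -nneseriesZl; last first.
  by move=> c _; rewrite mule_ge0 ?lee_fin ?poisson_weight_ge0//; apply: iid_mean_ge0.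
by apply: eq_eseriesr => c _; rewrite iid_meanZ// muleCA.
Qed.

(** Thinning is applied to one list at a time; the functional that remains after
    averaging over the other lists still ignores the entries that fail [u]. *)
Lemma joint_mean_thinning ss (u : pred T) F : (forall ls, 0 <= F ls) ->
  (forall ls, F ls = F (map (seq.filter u) ls)) ->
  joint_mean ss F =
  (expR (\sum_(s <- ss) r s * \sum_(t | ~~ u t) q s t))%:E *
  joint_mean ss (fun ls => if all (all u) ls then F ls else 0).
Proof.
elim: ss F => [|s ss IH] F F0 Fu; first by rewrite big_nil expR0 mul1e.
rewrite big_cons expRD EFinM -muleA /=.
set k := expR (\sum_(s <- ss) _).
pose G l := joint_mean ss (fun ls => F (l :: ls)).
have Gu l : G l = G (seq.filter u l).
  apply: eq_joint_mean => ls; rewrite Fu [RHS]Fu /= filter_id//.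
have G0 l : 0 <= G l by apply: joint_mean_ge0.
transitivity (cp_mean (r s) (q s) (fun l => G (seq.filter u l))).
  by apply: eq_cp_mean => l; rewrite -Gu.
rewrite cp_mean_thinning//; congr (_ * _).
have k0 : (0 <= k)%R by apply: expR_ge0.
rewrite -cp_meanZ//; last first.
  by move=> l; apply: joint_mean_ge0 => ls; case: ifP.
apply: eq_cp_mean => l; rewrite /restrict_all.
case: ifP => ul /=; last by rewrite joint_mean0 mule0.
have Fl : forall ls, F (l :: ls) = F (l :: map (seq.filter u) ls).
  by move=> ls; rewrite Fu [RHS]Fu /= -map_comp; congr (F (_ :: _));
     apply: eq_map => l' /=; rewrite filter_id.
by rewrite /G IH.
Qed.

End nested.

(** * Decomposition over counts and entries *)

Section total_probability.
Context {disp : measure_display} {Omega : measurableType disp} {R : realType}.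
Variable nu : {measure set Omega -> \bar R}.
Local Open Scope ereal_scope.

Lemma measure_total_fin (T : finType) (Y : Omega -> T) (E : set Omega) :
  (forall t, measurable [set o | Y o = t]) -> measurable E ->
  nu E = \sum_(t : T) nu (E `&` [set o | Y o = t]).
Proof.
move=> mY mE.
have -> : \sum_(t : T) nu (E `&` [set o | Y o = t]) =
          \sum_(t \in [set: T]) nu (E `&` [set o | Y o = t]).
  rewrite (_ : [set: T] = [set` index_enum T]).
    by rewrite -fsbig_seq ?index_enum_uniq.
  by apply/seteqP; split => // t _ /=; apply: mem_index_enum.
rewrite -measure_fin_bigcup//.
- rewrite -setI_bigcupr; congr (nu _); apply/seteqP; split => o; [move=> Eo|by case].
  by split => //; exists (Y o).
- exact: finite_finset.
- by move=> s t _ _ [ o [[_ /= <-] [_ <-]]].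
- by move=> t _; apply: measurableI.
Qed.

Lemma measure_total_nat (Y : Omega -> nat) (E : set Omega) :
  (forall t, measurable [set o | Y o = t]) -> measurable E ->
  nu E = \sum_(t <oo) nu (E `&` [set o | Y o = t]).
Proof.
move=> mY mE.
rewrite -measure_semi_bigcup//.
- rewrite -setI_bigcupr; congr (nu _); apply/seteqP; split => o; [move=> Eo|by case].
  by split => //; exists (Y o).
- by move=> t; apply: measurableI.
- by move=> s t _ _ [ o [[_ /= <-] [_ <-]]].
- by apply: bigcup_measurable => t _; apply: measurableI.
Qed.

(** Peeling off the head turns the event into a condition on [V 0] and the same
    kind of event for the shifted sequence and the length [(C o).-1]. *)
Lemma measurable_mkseq (T : Type) (C : Omega -> nat) (V : nat -> Omega -> T) l :
  (forall c, measurable [set o | C o = c]) ->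
  (forall k t, measurable [set o | V k o = t]) ->
  measurable [set o | mkseq (V ^~ o) (C o) = l].
Proof.
elim: l C V => [|t l IH] C V mC mV.
  rewrite (_ : [set o | _] = [set o | C o = 0%N]) //.
  apply/seteqP; split => o /=; last by move=> ->.
  by move/(congr1 size); rewrite size_mkseq.
rewrite (_ : [set o | _] = ~` [set o | C o = 0%N] `&` ([set o | V 0%N o = t] `&`
    [set o | mkseq (fun k => V k.+1 o) (C o).-1 = l])).
  apply: measurableI; first exact: measurableC.
  apply: measurableI => //; apply: (IH (fun o => (C o).-1)) => // -[|c].
    rewrite (_ : [set o | _] = [set o | C o = 0%N] `|` [set o | C o = 1%N]).
      exact: measurableU.
    by apply/seteqP; split => o /=; case: (C o) => [|[|k]] //=; auto; case.
  rewrite (_ : [set o | _] = [set o | C o = c.+2])//.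
  by apply/seteqP; split => o /=; case: (C o) => [|k] //=; [move=> ->|case].
have e c o : mkseq (V ^~ o) c.+1 = V 0%N o :: mkseq (fun k => V k.+1 o) c.
  by rewrite /mkseq /= -[1%N]/(1 + 0)%N iotaDl -map_comp.
apply/seteqP; split => o /=; case: (C o) => [//|c]; rewrite ?e //=.
  by case=> -> ->.
  by case=> /(_ erefl).
by case=> _ [-> ->].
Qed.

Lemma iid_mean_total (T : finType) (V : nat -> Omega -> T) (p : T -> R)
    c (E : set Omega) (w : R) (F : seq T -> \bar R) :
  (forall k t, measurable [set o | V k o = t]) -> measurable E ->
  (0 <= w)%R -> (forall t, (0 <= p t)%R) -> (forall l, 0 <= F l) ->
  (forall l, size l = c ->
     nu (E `&` [set o | mkseq (V ^~ o) c = l]) =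
     (w * \prod_(t <- l) p t)%:E * F l) ->
  nu E = w%:E * iid_mean p c F.
Proof.
move=> mV mE w0 p0; elim: c V mV E mE w w0 F => [|c IH] V mV E mE w w0 F F0 H.
  move: (H [::] erefl); rewrite big_nil mulr1 /= => <-.
  by congr (nu _); apply/seteqP; split => o; [move=> Eo|by case].
rewrite (measure_total_fin (mV 0%N) mE) /= ge0_sume_distrr; last first.
  by move=> t _; rewrite mule_ge0 ?lee_fin//; apply: iid_mean_ge0.
apply: eq_bigr => t _; rewrite muleA -EFinM.
apply: (IH (fun k => V k.+1)) => //.
- by apply: measurableI.
- by rewrite mulr_ge0.
- move=> l lc; have := H (t :: l); rewrite /= lc => /(_ erefl).
  rewrite big_cons mulrA => <-; congr (nu _).
  rewrite -setIA; congr (_ `&` _); apply/seteqP; split => o /=.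
    by case=> <- <-; rewrite /mkseq /= -[1%N]/(1 + 0)%N iotaDl -map_comp.
  by rewrite /mkseq /= -[1%N]/(1 + 0)%N iotaDl -map_comp => -[-> <-].
Qed.

Definition list_weight (T : finType) (x : R) (p : T -> R) (l : seq T) : R :=
  (poisson_weight x (size l) * \prod_(t <- l) p t)%R.

Lemma list_weight_ge0 (T : finType) x (p : T -> R) l :
  (0 <= x)%R -> (forall t, (0 <= p t)%R) -> (0 <= list_weight x p l)%R.
Proof.
by move=> x0 p0; rewrite mulr_ge0 ?poisson_weight_ge0// prodr_ge0.
Qed.

Lemma cp_mean_total (T : finType) (C : Omega -> nat) (V : nat -> Omega -> T)
    (x : R) (p : T -> R) (E : set Omega) (w : R) (F : seq T -> \bar R) :
  (forall c, measurable [set o | C o = c]) ->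
  (forall k t, measurable [set o | V k o = t]) -> measurable E ->
  (0 <= w)%R -> (0 <= x)%R -> (forall t, (0 <= p t)%R) -> (forall l, 0 <= F l) ->
  (forall l, nu (E `&` [set o | mkseq (V ^~ o) (C o) = l]) =
     (w * list_weight x p l)%:E * F l) ->
  nu E = w%:E * cp_mean x p F.
Proof.
move=> mC mV mE w0 x0 p0 F0 H.
rewrite (measure_total_nat mC mE) /cp_mean -nneseriesZl; last first.
  by move=> c _; rewrite mule_ge0 ?lee_fin ?poisson_weight_ge0//; apply: iid_mean_ge0.
apply: eq_eseriesr => c _; rewrite muleA -EFinM.
apply: (iid_mean_total mV) => //.
- exact: measurableI.
- by rewrite mulr_ge0// poisson_weight_ge0.
- move=> l lc; rewrite -mulrA -[in poisson_weight _ _]lc -H; congr (nu _).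
  rewrite -setIA; congr (_ `&` _); apply/seteqP; split => o /=; first by case=> ->.
  by move=> Cl; move: (lc); rewrite -{1}Cl size_mkseq => Cc; rewrite -Cc.
Qed.

(** Total probability over the values of all counts and entries. It suffices to
    know [nu] on each atom, where it has to be the product of the weights of the
    lists times the value of [F]; the constant [w] collects the weights of the
    lists that are already fixed. *)
Lemma joint_mean_total (T : finType) (I : Type) (r : I -> R) (q : I -> T -> R)
    (C : I -> Omega -> nat) (V : I -> nat -> Omega -> T)
    (ss : seq I) (E : set Omega) (w : R) (F : seq (seq T) -> \bar R) :
  (forall s, (0 <= r s)%R) -> (forall s t, (0 <= q s t)%R) ->
  (forall s c, measurable [set o | C s o = c]) ->
  (forall s k t, measurable [set o | V s k o = t]) -> measurable E ->
  (0 <= w)%R -> (forall ls, 0 <= F ls) ->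
  (forall ls, size ls = size ss ->
     nu (E `&` [set o | [seq mkseq (V s ^~ o) (C s o) | s <- ss] = ls]) =
     (w * \prod_(x <- zip ss ls) list_weight (r x.1) (q x.1) x.2)%:E * F ls) ->
  nu E = w%:E * joint_mean r q ss F.
Proof.
move=> r0 q0 mC mV; elim: ss E w F => [|s ss IH] E w F mE w0 F0 H.
  move: (H [::] erefl); rewrite big_nil mulr1 /= => <-.
  by congr (nu _); apply/seteqP; split => o; [move=> Eo|by case].
apply: (cp_mean_total (C := C s) (V := V s)) => //.
  by move=> l; apply: joint_mean_ge0.
move=> l; apply: IH => //.
- apply: measurableI => //.
  exact: measurable_mkseq.
- by rewrite mulr_ge0// list_weight_ge0.
- move=> ls lss; have := H (l :: ls); rewrite /= lss => /(_ erefl).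
  rewrite big_cons mulrA => <-; congr (nu _).
  rewrite -setIA; congr (_ `&` _); apply/seteqP; split => o /=.
    by case=> -> ->.
  by move=> [-> ->].
Qed.

End total_probability.

(** * Non-backtracking walks and routes to a leaf *)

Section neighborhoods.
Variables (d n : nat).
Implicit Types u w : vertex d.

Lemma adj_sym u w : adj u w = adj w u.
Proof. by case: u w => [k|y i] [l|y' i'] //=; rewrite orbC. Qed.

Lemma eq_spine k l : (spine k == spine l :> vertex d) = (k == l).
Proof. by apply/eqP/eqP => [[]|->]. Qed.

Lemma mem_spine_vertices k : (spine k \in vertices d n) = (k < n.+2)%N.
Proof.
rewrite mem_cat; apply/orP/idP => [[]|kn].
- by move=> /mapP[l]; rewrite mem_iota add0n => /andP[_ ?] [->].
- by move=> /allpairsP[[y i] [_ _ //]].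
- by left; apply/mapP; exists k; rewrite // mem_iota.
Qed.

Lemma mem_leaf_vertices y i : (leaf y i \in vertices d n) = (1 <= y <= n)%N.
Proof.
rewrite mem_cat; apply/orP/idP => [[]|yn].
- by move=> /mapP[l].
- move=> /allpairsP[[y' i'] [/=]]; rewrite mem_iota => yn _ [-> _] /=.
  by move: yn; rewrite add1n ltnS.
- right; apply/allpairsP; exists (y, i); split => //; last by rewrite mem_enum.
  by rewrite mem_iota add1n ltnS.
Qed.

Lemma uniq_vertices : uniq (vertices d n).
Proof.
rewrite cat_uniq map_inj_uniq ?iota_uniq /=; last by move=> ? ? [].
rewrite allpairs_uniq ?iota_uniq ?enum_uniq//; last first.
  by move=> [? ?] [? ?] _ _ [] -> ->.
rewrite andbT; apply/hasPn => w /allpairsP[[y i] [_ _ ->]]; apply/negP.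
by move=> /mapP[l].
Qed.

Lemma uniq_neighbors u : uniq (neighbors n u).
Proof. by rewrite filter_uniq// uniq_vertices. Qed.

Lemma mem_neighbors u w : (w \in neighbors n u) = adj u w && (w \in vertices d n).
Proof. by rewrite mem_filter. Qed.

Lemma starts_vertices u : starts n u -> u \in vertices d n.
Proof.
case: u => [l|y i] /=; rewrite ?mem_spine_vertices ?mem_leaf_vertices//.
by move=> /orP[]/eqP ->; lia.
Qed.

Lemma size_neighbors_spine k : (1 <= d)%N -> (1 <= k <= n)%N ->
  size (neighbors n (spine k : vertex d)) = d.+1.
Proof.
move=> d1 kn.
have -> : size (neighbors n (spine k : vertex d)) =
    size ([:: spine k.-1; spine k.+1] ++ [seq leaf k i | i <- enum 'I_d.-1]).
  apply/eqP; rewrite -uniq_size_uniq ?uniq_neighbors//.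
    rewrite cat_uniq map_inj_uniq ?enum_uniq /=; last by move=> ? ? [].
    rewrite inE !andbT; apply/andP; split; first by apply/eqP => -[]; lia.
    by apply/hasPn => w /mapP[i _ ->].
  move=> w; apply/esym; rewrite mem_neighbors [RHS]mem_cat.
  rewrite [X in _ = X || _]in_cons [X in _ = (_ || X) || _]mem_seq1.
  case: w => [l|y i].
    rewrite mem_spine_vertices /= !eq_spine.
    have -> : (spine l \in [seq leaf k i | i <- enum 'I_d.-1]) = false.
      by apply/negbTE/negP => /mapP[].
    by rewrite orbF; lia.
  rewrite mem_leaf_vertices /=; apply/idP/idP.
    by move=> /andP[/eqP <- _]; apply/mapP; exists i; rewrite ?mem_enum.
  by move=> /mapP[j _ [-> _]]; rewrite eqxx.
by rewrite size_cat size_map size_enum_ord /=; lia.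
Qed.

Lemma size_neighbors_end : size (neighbors n (spine n.+1 : vertex d)) = 1%N.
Proof.
have -> : size (neighbors n (spine n.+1 : vertex d)) = size [:: spine n : vertex d].
  apply/eqP; rewrite -uniq_size_uniq ?uniq_neighbors//.
  move=> w; apply/esym; rewrite mem_neighbors [RHS]mem_seq1; case: w => [l|y i].
    by rewrite mem_spine_vertices /= eq_spine; lia.
  by rewrite mem_leaf_vertices /=; apply/idP/idP => //; lia.
by [].
Qed.

Lemma size_neighbors_leaf y (i : 'I_d.-1) : (1 <= y <= n)%N ->
  size (neighbors n (leaf y i)) = 1%N.
Proof.
move=> yn; have -> : size (neighbors n (leaf y i)) = size [:: spine y : vertex d].
  apply/eqP; rewrite -uniq_size_uniq ?uniq_neighbors//.
  move=> w; apply/esym; rewrite mem_neighbors [RHS]mem_seq1; case: w => [l|y' i'].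
    by rewrite mem_spine_vertices /= eq_spine; lia.
  by [].
by [].
Qed.

End neighborhoods.

Section toward.
Variables (d : nat) (x : nat) (j : 'I_d.-1).
Implicit Types u w : vertex d.

(** The parent of [u] in the tree rooted at [leaf x j]; the root is its own
    parent. *)
Definition toward (u : vertex d) : vertex d :=
  match u with
  | spine k => if (k < x)%N then spine k.+1
               else if (x < k)%N then spine k.-1 else leaf x j
  | leaf y i => if leaf y i == leaf x j then leaf x j else spine y
  end.

Definition dist u : nat :=
  match u with
  | spine k => (`|k%:Z - x%:Z| + 1)%N
  | leaf y i => if leaf y i == leaf x j then 0%N else (`|y%:Z - x%:Z| + 2)%N
  end.

Lemma toward_target : toward (leaf x j) = leaf x j.
Proof. by rewrite /toward eqxx. Qed.

(** This is where it matters that the graph is a tree. *)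
Lemma adj_toward u w : adj u w -> toward u = w \/ toward w = u.
Proof.
wlog: u w / if u is spine k then if w is spine l then l = k.+1 else True else False.
  move=> H; case: u w => [k|y i] [l|y' i'] //=.
  - move=> /orP[/eqP kl|/eqP lk].
      by apply: (H (spine k) (spine l)); rewrite //= -kl eqxx.
    by apply/or_comm; apply: (H (spine l) (spine k)); rewrite //= -lk eqxx.
  - by move=> h; apply: (H (spine k) (leaf y' i')).
  - by move=> h; apply/or_comm; apply: (H (spine l) (leaf y i)); rewrite //= eq_sym.
case: u w => [k|y i] [l|y' i'] //.
  move=> -> _ /=; case: ltnP => kx; first by left.
  by right; rewrite ifF ?ifT//; lia.
move=> _ /= /eqP ->; case: eqP => [e|_]; last by right.
by left; case: e => -> ->; rewrite ltnn.
Qed.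

Lemma toward_neq_target u : u != leaf x j -> toward (toward u) != u.
Proof.
case: u => [k|y i] uz.
  rewrite {2}/toward; case: (ltngtP k x) => [kx|xk|e] /=; last by rewrite eqxx.
    by case: ltngtP => // h; rewrite eq_spine; lia.
  by case: ltngtP => // h; rewrite eq_spine; lia.
rewrite {2}/toward (negbTE uz) /=.
by case: ltngtP => // h; rewrite eq_sym.
Qed.

Lemma iter_toward_leaf y i m u :
  iter m.+1 toward u = leaf y i -> leaf y i = leaf x j.
Proof.
rewrite iterS; case: (iter m toward u) => [k|y' i'] /=.
  by case: ltngtP.
by case: ifP => // _ ->.
Qed.

Lemma dist_toward u : u != leaf x j -> dist u = (dist (toward u)).+1.
Proof.
case: u => [k|y i] uz /=.
  by case: (ltngtP k x) => [kx|xk|->] /=; rewrite ?eqxx; lia.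
by rewrite (negbTE uz) /=; lia.
Qed.

Lemma iter_dist u : iter (dist u) toward u = leaf x j.
Proof.
move e : (dist u) => m; elim: m u e => [|m IH] u e.
  apply/eqP; apply: contraT => uz; by rewrite (dist_toward uz) in e.
have uz : u != leaf x j.
  by apply/eqP => uz; rewrite uz /= eqxx in e.
by rewrite iterSr; apply: IH; rewrite (dist_toward uz) in e; case: e.
Qed.

End toward.

Section routes.
Variables (R : realType) (d n : nat).
Hypothesis d2 : (2 <= d)%N.
Implicit Types (u w s : vertex d) (xs : seq (vertex d)).

Lemma uniform_pmf_neq0 (l : seq (vertex d)) w : uniform_pmf R l w != 0 -> w \in l.
Proof. by rewrite /uniform_pmf; case: (w \in l) => //; rewrite mul0r eqxx. Qed.

Lemma nb_step_neighbor s prev u w :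
  (prev != None -> ~~ (is_leaf n u && (u != s))) ->
  nb_step R n s prev u w != 0 -> w \in neighbors n u /\ prev != Some w.
Proof.
case: prev => [p|] h /=; last by move=> /uniform_pmf_neq0.
rewrite (negbTE (h _))// => /uniform_pmf_neq0.
by rewrite mem_filter => /andP[wp ->]; split => //; apply: contra wp => /eqP[->].
Qed.

Lemma nb_path_prob_cons s prev u w xs :
  nb_path_prob R n s prev u (w :: xs) =
  nb_step R n s prev u w * nb_path_prob R n s (Some u) w xs.
Proof. by []. Qed.

Lemma nb_path_cons_neq0 s prev u w xs :
  nb_path_prob R n s prev u (w :: xs) != 0 ->
  nb_step R n s prev u w != 0 /\ nb_path_prob R n s (Some u) w xs != 0.
Proof. by rewrite /= mulf_eq0 negb_or => /andP. Qed.

Lemma nb_path_halted s p u xs : is_leaf n u -> u != s ->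
  nb_path_prob R n s (Some p) u xs != 0 -> xs = nseq (size xs) u.
Proof.
move=> lu us; elim: xs p => [//|w xs IH] p /=.
rewrite mulf_eq0 negb_or lu us /= pnatr_eq0 eqb0 negbK => /andP[/eqP -> h].
by rewrite -(IH _ h).
Qed.

Section target.
Variables (x : nat) (j : 'I_d.-1).
Hypothesis xn : (1 <= x <= n)%N.
Local Notation z := (leaf x j : vertex d).
Local Notation toward := (toward x j).

Let leaf_z : is_leaf n z.
Proof. by rewrite /is_leaf size_neighbors_leaf. Qed.

(** A walk that has just left the parent of its position can only go further
    down, and never meets the root [z]. *)
Lemma nb_path_lost s u xs : u != z ->
  nb_path_prob R n s (Some (toward u)) u xs != 0 -> z \notin xs.
Proof.
elim: xs u => [//|w xs IH] u uz.
have [/andP[lu us]|hu] := boolP (is_leaf n u && (u != s)).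
  move=> /(nb_path_halted lu us) /= [-> ->].
  by rewrite inE negb_or eq_sym uz /=; apply/negP => /nseqP[zu]; rewrite zu eqxx in uz.
move=> /nb_path_cons_neq0[hs h].
have [] := nb_step_neighbor (fun=> hu) hs.
rewrite mem_neighbors => /andP[uw _] wt.
have wu : toward w = u.
  by have [tu|//] := adj_toward x j uw; rewrite tu eqxx in wt.
have wz : w != z.
  by apply: contraNneq uz => wz; rewrite -wu wz toward_target.
by rewrite inE negb_or eq_sym wz /=; apply: (IH w) => //; rewrite wu.
Qed.

(** A walk that is to meet the root has to step to the parent each time, since
    otherwise it is lost. As the root is its own parent, the same iteration
    describes the walk after it has halted. *)
Lemma nb_path_found s prev u xs : s != z -> (prev = None -> u = s) ->
  prev != Some (toward u) -> z \in u :: xs ->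
  nb_path_prob R n s prev u xs != 0 -> xs = traject toward (toward u) (size xs).
Proof.
move=> sz; elim: xs u prev => [//|w xs IH] u prev ps pu zu.
have [eu|uz] := eqVneq u z.
  case: prev ps pu => [p|] ps pu; last by rewrite -(ps erefl) eu eqxx in sz.
  have us : u != s by rewrite eu eq_sym.
  move=> /(nb_path_halted _ us); rewrite eu => /(_ leaf_z) {1}->.
  rewrite toward_target; elim: (size _) => //= k {1}->.
  by rewrite eqxx.
have [/andP[hp /andP[lu us]]|hu] := boolP [&& prev != None, is_leaf n u & u != s].
  case: prev hp {ps pu} => // p _ /(nb_path_halted lu us) e.
  move: zu; rewrite in_cons eq_sym (negbTE uz) e => /nseqP[zu].
  by rewrite zu eqxx in uz.
have {}hu : prev != None -> ~~ (is_leaf n u && (u != s)) by move=> h; rewrite h in hu.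
move=> /nb_path_cons_neq0[/(nb_step_neighbor hu)[]].
rewrite mem_neighbors => /andP[uw _] pw h.
move: zu; rewrite inE eq_sym (negbTE uz) /= => zw.
have tu : toward u = w.
  have [//|tw] := adj_toward x j uw.
  have wz : w != z.
    by apply: contraNneq uz => wz; rewrite -tw wz toward_target.
  move: zw; rewrite inE eq_sym (negbTE wz) /=.
  by rewrite -tw in h; rewrite (negbTE (nb_path_lost wz h)).
rewrite /= tu; congr (_ :: _); apply: (IH w (Some u)) => //.
by rewrite -tu; apply: contra (toward_neq_target uz) => /eqP[<-].
Qed.

(** Starting at [z] itself is impossible, as the walk is lost after its first
    step. *)
Lemma nb_path_route s xs :
  z \in xs -> nb_path_prob R n s None s xs != 0 ->
  s != z /\ xs = traject toward (toward s) (size xs).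
Proof.
move=> zx h; have [e|sz] := eqVneq s z; last first.
  by split=> //; apply: nb_path_found h => //; rewrite inE zx orbT.
exfalso; case: xs zx h => [//|w xs] zx.
move=> /nb_path_cons_neq0[/uniform_pmf_neq0].
rewrite mem_neighbors => /andP[sw _] h.
have wz : w != z.
  by apply: contraTneq sw => ->; rewrite e.
have tw : toward w = s.
  have [|//] := adj_toward x j sw; rewrite e toward_target => zw.
  by rewrite -zw eqxx in wz.
rewrite -tw in h; have := nb_path_lost wz h.
by move: zx; rewrite inE eq_sym (negbTE wz) /= => ->.
Qed.

Lemma nb_step_inner s p k w : (1 <= k <= n)%N ->
  p \in neighbors n (spine k) -> w \in neighbors n (spine k) -> w != p ->
  nb_step R n s (Some p) (spine k) w = d%:R^-1.
Proof.
move=> kn pk wk wp; rewrite /nb_step /is_leaf size_neighbors_spine//; last by lia.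
rewrite eqSS ifF; last by lia.
rewrite /uniform_pmf mem_filter wp wk div1r size_filter.
congr (_%:R^-1); have := count_predC (pred1 p) (neighbors n (spine k)).
rewrite size_neighbors_spine//; last by lia.
rewrite (count_uniq_mem p (uniq_neighbors n (spine k))) pk add1n => -[h].
by apply: etrans h; apply: eq_count => v.
Qed.

Lemma toward_neighbor u : u \in vertices d n -> u != z ->
  toward u \in neighbors n u.
Proof.
move=> + uz; rewrite mem_neighbors; case: u uz => [k|y i] uz.
  rewrite mem_spine_vertices /=; case: (ltngtP k x) => [kx|xk|->] /=;
  rewrite ?mem_spine_vertices ?mem_leaf_vertices ?eqxx //; lia.
by rewrite mem_leaf_vertices /= (negbTE uz) /= mem_spine_vertices eqxx; lia.
Qed.

Lemma toward_spine u : u \in vertices d n ->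
  toward u = z \/ exists2 k, (1 <= k <= n)%N & toward u = spine k.
Proof.
case: u => [k|y i]; rewrite ?mem_spine_vertices ?mem_leaf_vertices => uv /=.
  by case: ltngtP => h; [right; exists k.+1|right; exists k.-1|left] => //; lia.
by case: ifP => h; [left|right; exists y].
Qed.

Lemma nb_path_prob_inner s p k :
  (1 <= k <= n)%N -> p \in neighbors n (spine k) -> p != toward (spine k) ->
  nb_path_prob R n s (Some p) (spine k)
    (traject toward (toward (spine k)) (dist x j (spine k))) =
  d%:R ^- dist x j (spine k).
Proof.
move e : (dist x j (spine k)) => m; elim: m k p e => [|m IH] k p e kn pk pt.
  by move: e => /=; lia.
have skz : spine k != z by [].
have skv : spine k \in vertices d n by rewrite mem_spine_vertices; lia.
rewrite trajectS nb_path_prob_cons.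
rewrite (nb_step_inner s kn pk (toward_neighbor skv skz)); last by rewrite eq_sym.
rewrite exprS invfM; congr (_ * _).
have em : dist x j (toward (spine k)) = m.
  by apply/eqP; rewrite -eqSS -dist_toward// e.
have pt' := toward_neq_target skz; rewrite eq_sym in pt'.
have := toward_neighbor skv skz; rewrite mem_neighbors => /andP[kw _].
have [tz|[k' k'n tk']] := toward_spine skv.
  by move: em; rewrite tz {1}/dist eqxx => <-; rewrite /= expr0 invr1.
move: kw em pt'; rewrite tk' => kw em pt'.
by apply: IH => //; rewrite mem_neighbors adj_sym kw.
Qed.

(** The geodesic to [z] has [dist x j s] steps; the first one goes to a uniform
    neighbor of [s], and each of the others to one of the [d] neighbors of an inner
    vertex of the path that were not just left. *)
Definition hit_prob s : R :=
  if s == z then 0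
  else (size (neighbors n s))%:R^-1 * d%:R ^- (dist x j s).-1.

Lemma nb_path_prob_route s : s \in vertices d n -> s != z ->
  nb_path_prob R n s None s (traject toward (toward s) (dist x j s)) = hit_prob s.
Proof.
move=> sv sz; rewrite /hit_prob (negbTE sz).
have sw := toward_neighbor sv sz.
rewrite (dist_toward sz) /= /uniform_pmf sw div1r; congr (_ * _).
have [->|[k kn tk]] := toward_spine sv.
  by rewrite /= eqxx expr0 invr1.
have pt' := toward_neq_target sz.
move: sw pt'; rewrite tk mem_neighbors => /andP[sk _] pt'.
by apply: nb_path_prob_inner => //; rewrite ?mem_neighbors 1?adj_sym ?sk// eq_sym.
Qed.

End target.
End routes.

(** * Activation as reachability *)

Section reach.
Variables (d n : nat) (a : nat -> 'I_d.-1 -> bool).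

(** The vertices v_{y,i} of the graph, with the row shifted down by one. *)
Definition site : Type := ('I_n * 'I_d.-1)%type.
HB.instance Definition _ := Finite.on site.

Definition leaf_of (z : site) : vertex d := leaf z.1.+1 z.2.

Definition wanted (z : site) : bool := a z.1.+1 z.2.

(** The possible outcomes of a walk are the leaf where it halts, or [None] when it
    meets no v_{y,i}. *)
Definition allowed : pred (option site) :=
  fun t => if t is Some z then wanted z else true.

(** The vertices that hold particles in the system where the sites with
    [a = false] are empty. *)
Definition awake_starts : seq (vertex d) :=
  [:: spine n, spine n.+1 & [seq leaf_of z | z <- enum {: site} & wanted z]].

(** The activation process, where [hits s] lists the leaves hit by the particles
    of [s]. *)
Inductive reach (hits : vertex d -> seq (option site)) : vertex d -> Prop :=
| reach_v : reach hits (spine n)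
| reach_v' : reach hits (spine n.+1)
| reach_hit s z : reach hits s -> Some z \in hits s -> reach hits (leaf_of z).

Definition hits_of (ls : seq (seq (option site))) (u : vertex d) :
    seq (option site) :=
  if u \in awake_starts then nth [::] ls (index u awake_starts) else [::].

Definition all_wanted_reached (ls : seq (seq (option site))) : bool :=
  `[< forall z, wanted z -> reach (hits_of ls) (leaf_of z) >].

Lemma leaf_of_inj : injective leaf_of.
Proof. by move=> [y i] [y' i'] [/val_inj -> ->]. Qed.

Lemma leafE y i : (1 <= y <= n)%N ->
  exists2 z : site, leaf y i = leaf_of z & a y i = wanted z.
Proof.
case: y => [//|y] yn; have yl : (y < n)%N by [].
by exists (Ordinal yl, i).
Qed.

Lemma mem_awake_leaf z : (leaf_of z \in awake_starts) = wanted z.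
Proof.
rewrite !in_cons /=; apply/mapP/idP => [[z' + /leaf_of_inj ->]|az].
  by rewrite mem_filter => /andP[].
by exists z; rewrite // mem_filter az mem_enum.
Qed.

Lemma awake_startsP u : u \in awake_starts ->
  [\/ u = spine n, u = spine n.+1 | exists2 z, u = leaf_of z & wanted z].
Proof.
rewrite !in_cons => /or3P[/eqP->|/eqP->|/mapP[z + ->]]; first by constructor.
  by constructor.
by rewrite mem_filter => /andP[az _]; constructor 3; exists z.
Qed.

Lemma awake_starts_uniq : uniq awake_starts.
Proof.
have spine_notin k : spine k \notin [seq leaf_of z | z <- enum {: site} & wanted z].
  by apply/negP => /mapP[].
rewrite 2!cons_uniq inE eq_spine negb_or !spine_notin ltn_eqF//= map_inj_uniq.
  exact/filter_uniq/enum_uniq.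
exact: leaf_of_inj.
Qed.

Lemma starts_awake u : u \in awake_starts -> starts n u.
Proof.
move=> /awake_startsP[->|->|[z -> _]] /=; rewrite ?eqxx ?orbT//.
Qed.

(** A hit of a site with [a = false] leads nowhere, as that site has no list of
    its own. *)
Lemma all_wanted_reached_filter ls :
  all_wanted_reached ls = all_wanted_reached (map (seq.filter allowed) ls).
Proof.
have hf u : hits_of (map (seq.filter allowed) ls) u = seq.filter allowed (hits_of ls u).
  rewrite /hits_of; case: ifP => // _.
  have [lt|ge] := ltnP (index u awake_starts) (size ls); first exact: nth_map.
  by rewrite !nth_default// size_map.
apply: asbool_equiv_eq; split => H z az.
- have G u : reach (hits_of ls) u ->
      u \in awake_starts -> reach (hits_of (map (seq.filter allowed) ls)) u.
    elim=> [_|_|s {}z {}az IH sz]; [exact: reach_v|exact: reach_v'|].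
    rewrite mem_awake_leaf => wz; apply: (@reach_hit _ s).
      by apply: IH; move: sz; rewrite /hits_of; case: ifP.
    by rewrite hf mem_filter sz andbT.
  by apply: G; [exact: H|rewrite mem_awake_leaf].
- have G u : reach (hits_of (map (seq.filter allowed) ls)) u -> reach (hits_of ls) u.
    elim=> [||s {}z {}az IH]; [exact: reach_v|exact: reach_v'|].
    by rewrite hf mem_filter => /andP[_ sz]; apply: reach_hit IH sz.
  exact/G/H.
Qed.

Section deterministic.
Variables (count : vertex d -> nat) (walk : vertex d -> nat -> nat -> vertex d).
Variable hit : vertex d -> nat -> option site.
Hypothesis count_starts : forall u, (0 < count u)%N -> starts n u.
Hypothesis hitP : forall u k z, starts n u ->
  (exists m, walk u k m.+1 = leaf_of z) <-> hit u k = Some z.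

Let ls := [seq mkseq (hit u) (count u) | u <- awake_starts].

Let hits_lsE u : u \in awake_starts -> hits_of ls u = mkseq (hit u) (count u).
Proof.
move=> us; rewrite /hits_of us (nth_map (spine 0)) ?index_mem//.
by rewrite nth_index.
Qed.

Let mem_hits u z : Some z \in hits_of ls u ->
  u \in awake_starts /\
  exists2 k, (k < count u)%N & exists m, walk u k m.+1 = leaf_of z.
Proof.
have [us|us] := boolP (u \in awake_starts); last by rewrite /hits_of (negbTE us).
rewrite hits_lsE// => /mapP[k]; rewrite mem_iota add0n => kc zk; split => //.
by exists k => //; apply/hitP => //; exact: starts_awake.
Qed.

Let mem_hits_walk u k m z : u \in awake_starts -> (k < count u)%N ->
  walk u k m.+1 = leaf_of z -> Some z \in hits_of ls u.
Proof.
move=> us ku h; rewrite hits_lsE//; apply/mapP; exists k; first by rewrite mem_iota.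
by apply/esym/hitP; [exact: starts_awake|exists m].
Qed.

(** Shared by the full system and by the one with empty sites: they have the same
    particles at the recorded starts, and in neither of them do particles from
    elsewhere move. *)
Lemma activated_reach (count' : vertex d -> nat) :
  (forall u, u \in awake_starts -> count' u = count u) ->
  (forall u, active n count' walk u -> (0 < count' u)%N -> u \in awake_starts) ->
  forall z, activated n count' walk (leaf_of z) <-> reach (hits_of ls) (leaf_of z).
Proof.
move=> H1 H2.
have act_reach u : active n count' walk u -> u \in awake_starts -> reach (hits_of ls) u.
  elim=> [_|_|s k m acts IH ks]; [exact: reach_v|exact: reach_v'|].
  have sA := H2 _ acts (leq_ltn_trans (leq0n k) ks).
  case/awake_startsP => [->|->|[z wz _]]; [exact: reach_v|exact: reach_v'|].
  rewrite wz; apply: (@reach_hit _ s); first exact: IH.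
  by apply: mem_hits_walk wz => //; rewrite -H1.
move=> z; split => [[s [k [m [acts ks wz]]]]|].
  have sA := H2 _ acts (leq_ltn_trans (leq0n k) ks).
  apply: (@reach_hit _ s); first exact: act_reach.
  by apply: mem_hits_walk wz => //; rewrite -H1.
have reach_act u : reach (hits_of ls) u ->
    active n count' walk u /\ forall z', u = leaf_of z' -> activated n count' walk u.
  elim=> [||s z' rs [acts _] /mem_hits[sA [k ks [m wz]]]].
  - by split=> //; exact: active_v.
  - by split=> //; exact: active_v'.
  - rewrite -wz; split; first by apply: active_wake; rewrite // H1.
    by move=> _ _; exists s, k, m; split; rewrite // H1.
by move=> /reach_act[_ /(_ z erefl)].
Qed.

Lemma thinned_activationP :
  (forall y i, (1 <= y <= n)%N -> a y i ->
     activated n (thin a count) walk (leaf y i)) <-> all_wanted_reached ls.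
Proof.
have AR : forall z, activated n (thin a count) walk (leaf_of z) <->
                    reach (hits_of ls) (leaf_of z).
  apply: activated_reach => [u /awake_startsP[->|->|[z -> /= az]]|u _] //=.
    by rewrite ifT.
  case: u => [k|y i] /=.
    move=> /count_starts /orP[]/eqP ->; rewrite !in_cons eqxx ?orbT//.
  case: ifP => // ay /count_starts /= /(leafE i)[z -> az].
  by rewrite mem_awake_leaf -az.
split=> [H|/asboolP H y i yn ay].
  by apply/asboolP => z az; apply/AR; apply: H => //=.
have [z e az] := leafE i yn.
by rewrite e; apply/AR; apply: H; rewrite -az.
Qed.

(** From left to right, only sites with [a = true] ever become active. From right
    to left, no hit leads to a site with [a = false], so the sites that are activated
    are those of the system where the sites with [a = false] are empty. *)
Lemma activationP :
  (forall y i, (1 <= y <= n)%N ->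
     `[< activated n count walk (leaf y i) >] = a y i) <->
  all_wanted_reached ls && all (all allowed) ls.
Proof.
have AR : (forall u, active n count walk u -> (0 < count u)%N -> u \in awake_starts) ->
  forall z, activated n count walk (leaf_of z) <-> reach (hits_of ls) (leaf_of z).
  by apply: activated_reach.
split=> [H|/andP[/asboolP H ok]].
- have actz z : activated n count walk (leaf_of z) -> wanted z.
    by move=> h; have := H z.1.+1 z.2 (ltn_ord _); rewrite /wanted => <-; apply/asboolP.
  have zact z : wanted z -> activated n count walk (leaf_of z).
    by move=> h; apply/asboolP; rewrite (H z.1.+1 z.2 (ltn_ord _)).
  have act_leaf u : active n count walk u ->
      forall z, u = leaf_of z -> activated n count walk u.
    by case=> // s k m acts ks z _; exists s, k, m.
  have {}AR z : activated n count walk (leaf_of z) <->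
                reach (hits_of ls) (leaf_of z).
    apply: AR z => u actu /count_starts.
    case: u actu => [k|y i] actu /=.
      by move=> /orP[]/eqP ->; rewrite !in_cons eqxx ?orbT.
    move=> /(leafE i)[z e _]; rewrite e mem_awake_leaf; apply: actz.
    by rewrite -e; apply: act_leaf e.
  apply/andP; split; first by apply/asboolP => z /zact/AR.
  apply/allP => l /mapP[s sA ->]; apply/allP => t /mapP[k].
  rewrite mem_iota add0n => ks ->; rewrite /allowed; case e : (hit s k) => [z|//].
  have /hitP[] := e; first exact: starts_awake.
  move=> m wz; apply: actz; rewrite -wz; exists s, k, m; split => //.
  case/awake_startsP : sA => [->|->|[z' -> /zact]]; [exact: active_v|exact: active_v'|].
  by case=> s' [k' [m' [acts' ks' <-]]]; apply: active_wake.
- have hits_ok s z : Some z \in hits_of ls s -> wanted z.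
    rewrite /hits_of; case: ifP => // sA sz; have := allP ok _ (mem_nth [::] _).
    move=> /(_ (index s awake_starts)); rewrite size_map index_mem => /(_ sA).
    by move=> /allP/(_ _ sz).
  have {}AR z : activated n count walk (leaf_of z) <->
                reach (hits_of ls) (leaf_of z).
    apply: AR z => u; elim=> [_|_|s k m acts IH ks].
    + by rewrite !in_cons eqxx.
    + by rewrite !in_cons eqxx orbT.
    + have sA := IH (leq_ltn_trans (leq0n k) ks).
      case e : (walk s k m.+1) => [l|y i] /count_starts /=.
        by move=> /orP[]/eqP ->; rewrite !in_cons eqxx ?orbT.
      move=> /(leafE i)[z ez _]; rewrite ez mem_awake_leaf; apply: (hits_ok s).
      by apply: (@mem_hits_walk s k m) => //; rewrite e ez.
  move=> y i yn; have [z -> ->] := leafE i yn.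
  apply/asboolP/idP => [/AR|/H/AR//].
  move e : (leaf_of z) => u ru; case: ru e => // s z' _ sz' /leaf_of_inj ->.
  exact: hits_ok sz'.
Qed.

End deterministic.
End reach.

(** * Measurability *)

Section measurability.
Context {disp : measure_display} {Omega : measurableType disp}.

Lemma measurable_set_ex (U : countType) (F : U -> Omega -> Prop) :
  (forall u, measurable [set o | F u o]) -> measurable [set o | exists u, F u o].
Proof.
move=> mF; rewrite (_ : [set o | _] = \bigcup_u [set o | F u o]).
  exact: countable_bigcupT_measurable.
by apply/seteqP; split => o /= [u]; exists u.
Qed.

Lemma measurable_set_not (F : Omega -> Prop) :
  measurable [set o | F o] -> measurable [set o | ~ F o].
Proof. exact: measurableC. Qed.

Lemma measurable_set_all (U : countType) (F : U -> Omega -> Prop) :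
  (forall u, measurable [set o | F u o]) -> measurable [set o | forall u, F u o].
Proof.
move=> mF; rewrite (_ : [set o | _] = ~` [set o | exists u, ~ F u o]).
  by apply: measurableC; apply: measurable_set_ex => u; exact: measurable_set_not.
apply/seteqP; split => o /=; first by move=> h [u nF]; exact: (nF (h u)).
by move/forallNP => h u; exact: contrapT (h u).
Qed.

Lemma measurable_cst_prop (p : Prop) : measurable [set _ : Omega | p].
Proof.
have [h|h] := pselect p.
  by rewrite (_ : [set _ | _] = setT)//; apply/seteqP; split.
by rewrite (_ : [set _ | _] = set0)//; apply/seteqP; split.
Qed.

Lemma measurable_set_and (F G : Omega -> Prop) :
  measurable [set o | F o] -> measurable [set o | G o] ->
  measurable [set o | F o /\ G o].
Proof. exact: measurableI. Qed.

Lemma measurable_set_or (F G : Omega -> Prop) :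
  measurable [set o | F o] -> measurable [set o | G o] ->
  measurable [set o | F o \/ G o].
Proof. exact: measurableU. Qed.

Lemma measurable_set_imp (F G : Omega -> Prop) :
  measurable [set o | F o] -> measurable [set o | G o] ->
  measurable [set o | F o -> G o].
Proof.
move=> mF mG; rewrite (_ : [set o | _] = [set o | ~ F o \/ G o]).
  by apply: measurable_set_or => //; apply: measurable_set_not.
apply/seteqP; split => o /=; last by case.
by move=> h; have [Fo|] := pselect (F o); [right; exact: h|left].
Qed.

Section active_measurable.
Variables (d n : nat) (count : vertex d -> Omega -> nat)
  (walk : vertex d -> nat -> nat -> Omega -> vertex d).
Hypothesis mcount : forall u c, measurable [set o | count u o = c].
Hypothesis mwalk : forall u k m v, measurable [set o | walk u k m o = v].

(** The chains of at most [j] activations. Only countably many events enter each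
    level, whereas [active] is an inductive predicate. *)
Fixpoint active_within (j : nat) (u : vertex d) (o : Omega) : Prop :=
  match j with
  | 0 => u = spine n \/ u = spine n.+1
  | j'.+1 => active_within j' u o \/
      exists s k m, [/\ active_within j' s o, (k < count s o)%N & walk s k m.+1 o = u]
  end.

Lemma active_withinP u o :
  active n (count ^~ o) (fun u k m => walk u k m o) u <-> exists j, active_within j u o.
Proof.
split.
  elim=> [||s k m acts [j js] ks]; [by exists 0; left|by exists 0; right|].
  by exists j.+1; right; exists s, k, m.
move=> [j]; elim: j u => [u [->|->]|j IH u [/IH//|[s [k [m [/IH acts ks <-]]]]]].
- exact: active_v.
- exact: active_v'.
- exact: (@active_wake _ n (count ^~ o) (fun u k m => walk u k m o)).
Qed.

Let measurable_wake (F : vertex d -> Omega -> Prop) u :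
  (forall s, measurable [set o | F s o]) ->
  measurable [set o | exists s k m,
    [/\ F s o, (k < count s o)%N & walk s k m.+1 o = u]].
Proof.
move=> mF; apply: measurable_set_ex => s; apply: measurable_set_ex => k.
apply: measurable_set_ex => m.
rewrite (_ : [set o | _] = [set o | F s o /\ ((exists c, (k < c)%N /\ count s o = c)
   /\ walk s k m.+1 o = u)]).
  apply: measurable_set_and => //; apply: measurable_set_and => //.
  apply: measurable_set_ex => c.
  by apply: measurable_set_and => //; exact: measurable_cst_prop.
apply/seteqP; split => o /=.
  by move=> [Fo ko wo]; split => //; split => //; exists (count s o).
by move=> [Fo [[c [kc cE]] wo]]; split => //; rewrite cE.
Qed.

Lemma measurable_active u :
  measurable [set o | active n (count ^~ o) (fun u k m => walk u k m o) u].
Proof.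
rewrite (_ : [set o | _] = [set o | exists j, active_within j u o]); last first.
  by apply/seteqP; split => o /active_withinP.
apply: measurable_set_ex => j; elim: j u => [|j IH] u; first exact: measurable_cst_prop.
by apply: measurable_set_or => //; exact: measurable_wake.
Qed.

Lemma measurable_activated u :
  measurable [set o | activated n (count ^~ o) (fun u k m => walk u k m o) u].
Proof. by apply: measurable_wake => s; exact: measurable_active. Qed.
End active_measurable.

Section unique_hit.
Variables (d n : nat) (X : nat -> Omega -> vertex d).

Definition visits (z : site d n) (o : Omega) : Prop := exists m, X m.+1 o = leaf_of z.

(** Requiring uniqueness costs a null event only, and makes the outcome a function
    of the walk that involves no arbitrary choice. *)
Definition unique_hit (o : Omega) : option (site d n) :=
  [pick z : site d n | `[< visits z o /\ forall z', visits z' o -> z' = z >]].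

Lemma unique_hitP z o :
  unique_hit o = Some z <-> visits z o /\ forall z', visits z' o -> z' = z.
Proof.
rewrite /unique_hit; case: pickP => [z0 /asboolP[v0 u0]|H].
  split; first by case=> <-.
  by move=> [vz _]; rewrite (u0 _ vz).
by split => // h; have := H z; move/asboolP.
Qed.

(** Stated for an arbitrary measurable space, so that it also applies to the
    sigma-algebra generated by the walk. *)
Lemma measurable_unique_hit t :
  (forall m v, measurable [set o | X m o = v]) ->
  measurable [set o | unique_hit o = t].
Proof.
move=> mX; have mv z : measurable [set o | visits z o].
  by apply: measurable_set_ex => m.
have mS z : measurable [set o | unique_hit o = Some z].
  rewrite (_ : [set o | _] =
      [set o | visits z o /\ forall z', visits z' o -> z' = z]); last first.
    by apply/seteqP; split => o /unique_hitP.
  apply: measurable_set_and => //; apply: measurable_set_all => z'.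
  by apply: measurable_set_imp => //; exact: measurable_cst_prop.
case: t => [z//|].
rewrite (_ : [set o | _] = [set o | ~ exists z, unique_hit o = Some z]).
  by apply: measurable_set_not; apply: measurable_set_ex.
apply/seteqP; split => o /=; first by move=> -> [].
by case: (unique_hit o) => // z []; exists z.
Qed.

End unique_hit.
End measurability.

(** * Conditioning on an event of positive probability *)

Section conditioned.
Context {disp : measure_display} {Omega : measurableType disp} {R : realType}
  (P : probability Omega R) (N : set Omega).
Hypotheses (mN : measurable N) (N_pos : (0 < P N)%E).
Local Notation Q := (cprob P ^~ N).
Definition restricted : {measure set Omega -> \bar R} := mrestr P mN.
Local Notation nu := restricted.

Lemma restrictedE E : nu E = P (E `&` N).
Proof. by []. Qed.

Lemma fine_N_gt0 : 0 < fine (P N).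
Proof. by apply: fine_gt0; rewrite N_pos ltey_eq fin_num_measure. Qed.

Lemma cprob_restr E : measurable E -> nu E = (fine (P N) * Q E)%:E.
Proof.
move=> mE; rewrite /cprob mulrC divfK; last by rewrite gt_eqF// fine_N_gt0.
by rewrite fineK// fin_num_measure//; exact: measurableI.
Qed.

Lemma cprob_ge0 E : 0 <= Q E.
Proof. by rewrite /cprob divr_ge0 ?fine_ge0. Qed.

Lemma restr_eq0 E : measurable E -> Q E = 0 -> nu E = 0%E.
Proof. by move=> mE QE; rewrite cprob_restr// QE mulr0. Qed.

Lemma cprob_total_fin (T : finType) (Y : Omega -> T) :
  (forall t, measurable [set o | Y o = t]) -> \sum_t Q [set o | Y o = t] = 1.
Proof.
move=> mY; have := @measure_total_fin _ _ _ nu _ _ setT mY measurableT.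
rewrite (eq_bigr (fun t => (fine (P N) * Q [set o | Y o = t])%:E)); last first.
  by move=> t _; rewrite setTI cprob_restr.
rewrite sumEFin -mulr_sumr => h.
have : (fine (P N))%:E = (fine (P N) * \sum_t Q [set o | Y o = t])%:E.
  rewrite -[RHS]h fineK ?fin_num_measure//.
  by rewrite restrictedE setTI.
move=> [] /esym; rewrite -[RHS]mulr1; apply: mulfI.
by rewrite gt_eqF// fine_N_gt0.
Qed.

Lemma restr_not E : measurable E -> Q E = 1 -> nu [set o | ~ E o] = 0%E.
Proof.
move=> mE QE; have mnE := measurableC mE; rewrite cprob_restr//.
have : P N = (nu E + nu (~` E))%E.
  rewrite -measureU//; last by rewrite setICr.
  by rewrite setUv -[RHS]/(P (setT `&` N)) setTI.
rewrite !cprob_restr// QE mulr1 -EFinD.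
rewrite -[P N]fineK ?fin_num_measure// => -[] /eqP.
by rewrite -[X in X == _]addr0 => /eqP /addrI <-.
Qed.

Lemma eq_restr_null (B E F : set Omega) :
  measurable B -> nu B = 0%E -> measurable E -> measurable F ->
  (forall o, N o -> ~ B o -> (E o <-> F o)) -> nu E = nu F.
Proof.
move=> mB B0 mE mF EF.
have null G : measurable G -> nu G = nu (G `\` B).
  move=> mG; have GB : nu (G `&` B) = 0%E.
    by apply: (subset_measure0 (B := B)) => //; exact: measurableI.
  transitivity (nu (G `\` B) + nu (G `&` B))%E; first exact: measureDI.
  by rewrite GB adde0.
rewrite (null E)// (null F)//; rewrite !restrictedE; congr (P _); apply/seteqP.
by split => o [] [Eo nB] No; split => //; split => //; apply/(EF o).
Qed.

Lemma eq_cprob_null (B E F : set Omega) :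
  measurable B -> nu B = 0%E -> measurable E -> measurable F ->
  (forall o, N o -> ~ B o -> (E o <-> F o)) -> Q E = Q F.
Proof.
move=> mB B0 mE mF EF; have := eq_restr_null mB B0 mE mF EF.
rewrite !cprob_restr// => -[]; apply: mulfI.
by rewrite gt_eqF// fine_N_gt0.
Qed.

End conditioned.

Section null_sets.
Context {disp : measure_display} {Omega : measurableType disp} {R : realType}.
Variable m : {measure set Omega -> \bar R}.

Lemma null_ex (U : countType) (F : U -> Omega -> Prop) :
  (forall u, measurable [set o | F u o]) -> (forall u, m [set o | F u o] = 0%E) ->
  m [set o | exists u, F u o] = 0%E.
Proof.
move=> mF F0; apply/negligibleP; first exact: measurable_set_ex.
rewrite (_ : [set o | _] =
  \bigcup_i (if unpickle i is Some u then [set o | F u o] else set0)).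
  apply: negligible_bigcup => i; case: unpickle => [u|]; last exact: negligible_set0.
  by apply/negligibleP; [exact: mF|exact: F0].
apply/seteqP; split => o /=.
  by move=> [u Fu]; exists (pickle u) => //; rewrite pickleK.
by move=> [i _]; case: unpickle => // u Fu; exists u.
Qed.

Lemma null_or (F G : Omega -> Prop) :
  measurable [set o | F o] -> measurable [set o | G o] ->
  m [set o | F o] = 0%E -> m [set o | G o] = 0%E -> m [set o | F o \/ G o] = 0%E.
Proof.
move=> mF mG F0 G0; apply/negligibleP; first exact: measurable_set_or.
by apply: (@negligibleU _ _ _ m [set o | F o] [set o | G o]); apply/negligibleP.
Qed.

Lemma null_and_cst (p : Prop) (F : Omega -> Prop) :
  (p -> m [set o | F o] = 0%E) -> m [set o | p /\ F o] = 0%E.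
Proof.
have [h|h] := pselect p; last first.
  move=> _; rewrite (_ : [set o | _] = set0) ?measure0//.
  by apply/seteqP; split => o // [].
move=> /(_ h) <-; congr (m _); apply/seteqP; split => o; first by case.
by split.
Qed.
End null_sets.

(** At rate 0 this is the Dirac measure at 0, as [0 ^+ 0 = 1]. *)
Lemma fine_poisson_prob1 {R : realType} (r : R) c : 0 <= r ->
  fine (poisson_prob r 0%N [set c]) = poisson_weight r c.
Proof.
move=> r0; rewrite /poisson_prob /poisson_weight; case: ifPn => [r1|].
  rewrite esum_set1/= /poisson_pmf r1// lee_fin mulr_ge0 ?expR_ge0//.
  by rewrite divr_ge0// exprn_ge0.
rewrite -leNgt => r1; have -> : r = 0 by apply/le_anti/andP.
rewrite oppr0 expR0 mulr1 diracE; case: c => [|c].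
  by rewrite mem_set//= expr0 fact0 divr1.
by rewrite memNset//= expr0n /= mul0r.
Qed.

(** * Laws of the particle counts and of the leaves hit *)

Section walk_laws.
Variables (R : realType) (d : nat) (mu lam al : R) (disp : measure_display)
  (Omega : measurableType disp) (P : probability Omega R) (S : particle_system P d)
  (n : nat).
Hypotheses (hd : (2 <= d)%N) (hmu : 0 <= mu) (hlam : 0 <= lam).
Hypothesis hS : is_particle_system al mu (poisson_prob lam 0%N) S.
Hypothesis N_pos : (0 < P (N_is S n))%E.
Local Notation N := (N_is S n).
Local Notation Q := (cprob P ^~ N).

Lemma measurable_rv_nat (X : {RV P >-> nat}) c : measurable [set o | X o = c].
Proof. by rewrite -[X in measurable X]/(X @^-1` [set c]); exact: measurable_funPTI. Qed.

Lemma measurable_rv_vertex (X : {RV P >-> vertex d}) v : measurable [set o | X o = v].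
Proof. by rewrite -[X in measurable X]/(X @^-1` [set v]); exact: measurable_funPTI. Qed.

Lemma measurable_N : measurable N.
Proof. exact: measurable_rv_nat. Qed.

Local Notation nu := (restricted P measurable_N).

Definition follows (u : vertex d) (k : nat) (xs : seq (vertex d)) : set Omega :=
  [set o | ps_walk S u k 0%N o = u /\
     forall m, (m < size xs)%N -> ps_walk S u k m.+1 o = nth u xs m].

Lemma measurable_follows u k xs : measurable (follows u k xs).
Proof.
apply: measurable_set_and; first exact: measurable_rv_vertex.
apply: measurable_set_all => m.
apply: measurable_set_imp; first exact: measurable_cst_prop.
exact: measurable_rv_vertex.
Qed.

(** There are countably many finite paths, so this is a null event, and off it the
    statements on paths of positive probability hold surely. *)
Definition bad_walk (u : vertex d) (k : nat) : set Omega :=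
  [set o | ~ follows u k [::] o \/
     exists xs, nb_path_prob R n u None u xs = 0 /\ follows u k xs o].

Lemma measurable_bad_walk u k : measurable (bad_walk u k).
Proof.
apply: measurable_set_or; first exact/measurable_set_not/measurable_follows.
apply: measurable_set_ex => xs.
apply: measurable_set_and; first exact: measurable_cst_prop.
exact: measurable_follows.
Qed.

Lemma bad_walk_null u k : starts n u -> nu (bad_walk u k) = 0%E.
Proof.
move=> su; have mf xs := measurable_follows u k xs.
have fE xs : Q (follows u k xs) = nb_path_prob R n u None u xs by exact: (walk_law hS).
apply: null_or.
- exact/measurable_set_not/mf.
- apply: measurable_set_ex => xs; apply: measurable_set_and; last exact: mf.
  exact: measurable_cst_prop.
- by apply: restr_not; rewrite // fE.
- apply: null_ex => xs.
    apply: measurable_set_and; last exact: mf.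
    exact: measurable_cst_prop.
  apply: null_and_cst => x0.
  by apply: (restr_eq0 _ N_pos (mf xs)); rewrite fE.
Qed.


Definition walk_hit (u : vertex d) (k : nat) : Omega -> option (site d n) :=
  unique_hit n (ps_walk S u k).

Lemma measurable_walk_hit u k t : measurable [set o | walk_hit u k o = t].
Proof. by apply: measurable_unique_hit => m v; exact: measurable_rv_vertex. Qed.

Lemma nth_route (T : Type) (f : T -> T) (x x0 : T) i k :
  (i < k)%N -> nth x0 (traject f x k) i = iter i f x.
Proof. by move=> ik; rewrite (set_nth_default x) ?size_traject// nth_traject. Qed.

(** Applying [nb_path_route] to all finite stretches of the walk. *)
Lemma good_walk_route u k o (z : site d n) m :
  ~ bad_walk u k o -> ps_walk S u k m.+1 o = leaf_of z ->
  u != leaf_of z /\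
  forall m', ps_walk S u k m'.+1 o = iter m'.+1 (toward z.1.+1 z.2) u.
Proof.
move=> good wz.
have f0 M : follows u k (mkseq (fun i => ps_walk S u k i.+1 o) M) o.
  split.
    have [[]//|nf] := pselect (follows u k [::] o).
    by case: good; left.
  by move=> i; rewrite size_mkseq => iM; rewrite nth_mkseq.
have p0 M : nb_path_prob R n u None u (mkseq (fun i => ps_walk S u k i.+1 o) M) != 0.
  apply/eqP => p0; apply: good; right.
  by exists (mkseq (fun i => ps_walk S u k i.+1 o) M).
have zn : (1 <= z.1.+1 <= n)%N by exact: ltn_ord z.1.
have route M : (m < M)%N -> u != leaf_of z /\
    mkseq (fun i => ps_walk S u k i.+1 o) M =
    traject (toward z.1.+1 z.2) (toward z.1.+1 z.2 u) M.
  move=> mM; have := nb_path_route zn _ (p0 M); rewrite size_mkseq; apply.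
  by apply/mapP; exists m; rewrite ?mem_iota.
split=> [|m']; first by have [] := route m.+1 (ltnSn _).
have [_ e] := route (maxn m m').+1 (leq_maxl _ _).
have mm : (m' < (maxn m m').+1)%N by exact: leq_maxr.
rewrite -[LHS](nth_mkseq u (fun i => ps_walk S u k i.+1 o) mm) e.
by rewrite nth_route// iterSr.
Qed.

Lemma good_walk_hitP u k o z : ~ bad_walk u k o ->
  (exists m, ps_walk S u k m.+1 o = leaf_of z) <-> walk_hit u k o = Some z.
Proof.
move=> good; rewrite unique_hitP; split=> [[m wz]|[//]].
split; first by exists m.
move=> z' [m' wz']; have [_ route] := good_walk_route good wz.
have := route m'; rewrite wz' => /esym/iter_toward_leaf.
by move=> e; exact: leaf_of_inj e.
Qed.

(** Up to a null event, hitting [z] means following the geodesic to [z], which is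
    an event on finitely many steps. *)
Lemma walk_hit_law u k z : starts n u ->
  Q [set o | walk_hit u k o = Some z] = hit_prob R n z.1.+1 z.2 u.
Proof.
move=> su; have zn : (1 <= z.1.+1 <= n)%N by exact: ltn_ord z.1.
have [uz|uz] := eqVneq u (leaf_of z).
  rewrite /hit_prob ifT ?uz ?eqxx// -uz -[RHS](_ : Q set0 = 0); last first.
    by rewrite /cprob set0I measure0 mul0r.
  apply: (eq_cprob_null N_pos (measurable_bad_walk u k) (bad_walk_null k su)) => //.
    exact: measurable_walk_hit.
  move=> o _ good /=; split => // h; have [m wz] := (good_walk_hitP z good).2 h.
  by have [] := good_walk_route good wz; rewrite uz eqxx.
rewrite -(nb_path_prob_route R hd zn (starts_vertices su) uz) -(walk_law hS N_pos k su).
apply: (eq_cprob_null N_pos (measurable_bad_walk u k) (bad_walk_null k su)).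
- exact: measurable_walk_hit.
- exact: measurable_follows.
move=> o _ good /=; split=> [h|[_]].
  have [m wz] := (good_walk_hitP z good).2 h.
  have [_ route] := good_walk_route good wz; split.
    have [[]//|nf] := pselect (follows u k [::] o).
    by case: good; left.
  by move=> i; rewrite size_traject => im; rewrite nth_route// -iterSr.
rewrite size_traject => f; apply/(good_walk_hitP z good).
have := iter_dist z.1.+1 z.2 u; rewrite (dist_toward uz) in f *.
move=> e; exists (dist z.1.+1 z.2 (toward z.1.+1 z.2 u)).
by rewrite f// nth_route// -iterSr.
Qed.

Lemma walk_hit_None_law u k : starts n u ->
  Q [set o | walk_hit u k o = None] =
  1 - \sum_(z : site d n) hit_prob R n z.1.+1 z.2 u.
Proof.
move=> su; have := cprob_total_fin measurable_N N_pos (measurable_walk_hit u k).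
rewrite (bigD1 None)//= => <-.
rewrite (reindex_omap Some id)/=; last by case.
under eq_bigl do rewrite eqxx.
by under eq_bigr do rewrite walk_hit_law//; rewrite addrK.
Qed.

(** The walk number 0 stands for all of them, by [hit_lawE]. *)
Definition hit_law (u : vertex d) (t : option (site d n)) : R :=
  Q [set o | walk_hit u 0%N o = t].

Lemma hit_lawE u k t : starts n u -> Q [set o | walk_hit u k o = t] = hit_law u t.
Proof.
move=> su; rewrite /hit_law; case: t => [z|]; first by rewrite !walk_hit_law.
by rewrite !walk_hit_None_law.
Qed.

(** The counts as they are when [N = n]; unlike [ps_count], this does not involve
    the value of [N]. *)
Definition start_count (u : vertex d) (o : Omega) : nat :=
  match u with
  | spine k => if k == n then ps_X S o
               else if k == n.+1 then ps_X' S o else 0%N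
  | leaf y i => if (1 <= y <= n)%N then ps_W S y i o else 0%N
  end.

Definition start_rate (u : vertex d) : R := if u == spine n then mu else lam.

Lemma start_rate_ge0 u : 0 <= start_rate u.
Proof. by rewrite /start_rate; case: ifP. Qed.

Lemma measurable_start_count u c : measurable [set o | start_count u o = c].
Proof.
case: u => [k|y i] /=.
  case: (k == n); first exact: measurable_rv_nat.
  case: (k == n.+1); first exact: measurable_rv_nat.
  exact: measurable_cst_prop.
case: (1 <= y <= n)%N; first exact: measurable_rv_nat.
exact: measurable_cst_prop.
Qed.

Lemma start_count_law u c : starts n u ->
  Q [set o | start_count u o = c] = poisson_weight (start_rate u) c.
Proof.
rewrite -fine_poisson_prob1 ?start_rate_ge0// /start_rate.
case: u => [k|y i] /=.
  move=> /orP[]/eqP ->; first by rewrite !eqxx; exact: (X_law hS N_pos [set c]).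
  by rewrite eq_spine eqn_leq ltnn /= eqxx; exact: (X'_law hS N_pos [set c]).
by move=> yn; rewrite yn /=; exact: (W_law hS N_pos i yn [set c]).
Qed.

Lemma ps_count_start o : N o -> ps_count S o = start_count ^~ o.
Proof.
rewrite /N_is /= => No; apply/funext => -[k|y i] /=; rewrite No.
  by case: ifP => // _; case: ifP.
by case: ifP.
Qed.

Definition count_source (u : vertex d) : source d :=
  match u with
  | spine k => if k == n then src_X d else src_X' d
  | leaf y i => src_W y i
  end.

Lemma count_source_present u : starts n u -> present n (count_source u).
Proof. by case: u => [k|y i] //=; case: ifP. Qed.

Lemma count_source_event u c : starts n u ->
  source_events S (count_source u) [set o | start_count u o = c].
Proof.
move=> su; have H (X : {RV P >-> nat}) :
    preimage_set_system setT X measurable [set o | X o = c].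
  by exists [set c] => //; rewrite setTI.
case: u su => [k|y i] /= su; last by rewrite su; exact: H.
case: (k == n) su => /= [_|->]; exact: H.
Qed.

(** The measurability of the outcome is applied to the space with the sigma-algebra
    generated by the walk. *)
Lemma walk_source_event u k t :
  source_events S (src_walk u k) [set o | walk_hit u k o = t].
Proof.
pose G := \bigcup_m preimage_set_system setT (ps_walk S u k m) measurable.
rewrite /= -/G.
have := @measurable_unique_hit _ (g_sigma_algebraType G) d n (ps_walk S u k) t.
apply => m v; apply: sub_sigma_algebra; exists m => //.
by exists [set v] => //; rewrite setTI.
Qed.

End walk_laws.

(** * Joint law of the lists of leaves hit *)

HB.instance Definition _ (d : nat) := gen_eqMixin (source d).

Section atom_probabilities.
Variables (R : realType) (d : nat) (mu lam al : R) (disp : measure_display)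
  (Omega : measurableType disp) (P : probability Omega R) (S : particle_system P d)
  (n : nat).
Hypotheses (hd : (2 <= d)%N) (hmu : 0 <= mu) (hlam : 0 <= lam).
Hypothesis hS : is_particle_system al mu (poisson_prob lam 0%N) S.
Hypothesis N_pos : (0 < P (N_is S n))%E.
Local Notation N := (N_is S n).
Local Notation Q := (cprob P ^~ N).
Local Notation nu := (restricted P (measurable_N S n)).

Lemma independent_sources (rs : seq (source d)) (Ev : source d -> set Omega) :
  uniq rs ->
  (forall r, r \in rs -> present n r /\ source_events S r (Ev r)) ->
  Q [set o | forall r, r \in rs -> Ev r o] = \prod_(r <- rs) Q (Ev r).
Proof.
move=> urs H; rewrite big_tnth.
rewrite -(sources_independent hS N_pos (s := tnth (in_tuple rs))
  (E := fun i => Ev (tnth (in_tuple rs) i))).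
- congr (cprob P _ _); apply/seteqP; split => o /= h.
    by move=> i; apply: h; exact: mem_tnth.
  by move=> r /(tnthP (in_tuple rs))[i ->].
- by apply/tuple_uniqP.
- by move=> i; apply: H; exact: mem_tnth.
Qed.

Section atoms.
Variables (ss : seq (vertex d)) (lf : vertex d -> seq (option (site d n))).
Hypotheses (uniq_ss : uniq ss) (starts_ss : forall s, s \in ss -> starts n s).

(** The sources of randomness that decide the list of the start [s], when that
    list is to be [lf s]. *)
Definition block (s : vertex d) : seq (source d) :=
  count_source n s :: [seq src_walk s k | k <- iota 0 (size (lf s))].

(** The start that a source belongs to; it shows that the blocks are disjoint. *)
Definition owner (r : source d) : vertex d :=
  match r with
  | src_X => spine n
  | src_X' => spine n.+1
  | src_W y i => leaf y i
  | src_walk u _ => u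
  end.

Definition atom_event (r : source d) : set Omega :=
  match r with
  | src_walk u k => [set o | walk_hit S n u k o = nth None (lf u) k]
  | _ => [set o | start_count S n (owner r) o = size (lf (owner r))]
  end.

Lemma owner_count_source (s : vertex d) : starts n s -> owner (count_source n s) = s.
Proof.
case: s => [k|y i] //=; case: (eqVneq k n) => [->//|_] /= /eqP ->.
by [].
Qed.

Lemma owner_block (s : vertex d) r : starts n s -> r \in block s -> owner r = s.
Proof.
move=> st; rewrite in_cons => /orP[/eqP ->|/mapP[k _ ->]//].
exact: owner_count_source.
Qed.

Lemma count_source_not_walk (s : vertex d) u k : count_source n s <> src_walk u k.
Proof. by case: s => [l|y i] //=; case: ifP. Qed.

Lemma uniq_block (s : vertex d) : uniq (block s).
Proof.
rewrite cons_uniq map_inj_uniq ?iota_uniq ?andbT; last by move=> ? ? [].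
by apply/negP => /mapP[k _]; exact: count_source_not_walk.
Qed.

Lemma uniq_blocks : uniq (flatten [seq block s | s <- ss]).
Proof.
elim: ss uniq_ss starts_ss => [//|s tl IH] /andP[s_tl utl] st.
rewrite map_cons -[flatten _]/(block s ++ flatten _) cat_uniq uniq_block.
rewrite IH ?andbT//=; last first.
  by move=> s' s'tl; apply: st; rewrite inE s'tl orbT.
apply/hasPn => r /flatten_mapP[s' s'tl rs']; apply: contra s_tl => rs.
have st' : starts n s' by apply: st; rewrite inE s'tl orbT.
by rewrite -(owner_block (st _ (mem_head _ _)) rs) (owner_block st' rs').
Qed.

Lemma atom_event_count (s : vertex d) : starts n s ->
  atom_event (count_source n s) = [set o | start_count S n s o = size (lf s)].
Proof.
move=> st; have := owner_count_source st; rewrite /atom_event.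
by case e : (count_source n s) => [||y i|u k] // <-//; case: (count_source_not_walk e).
Qed.

Lemma block_prob (s : vertex d) : starts n s ->
  \prod_(r <- block s) Q (atom_event r) =
  list_weight (start_rate mu lam n s) (hit_law S s) (lf s).
Proof.
move=> st; rewrite big_cons atom_event_count// (start_count_law hmu hlam hS N_pos)//.
congr (_ * _); rewrite big_map /= (big_nth None) /index_iota subn0.
by apply: eq_bigr => k _; rewrite (hit_lawE hd hS N_pos).
Qed.

Lemma block_occursP (s : vertex d) o : starts n s ->
  (forall r, r \in block s -> atom_event r o) <->
  mkseq (walk_hit S n s ^~ o) (start_count S n s o) = lf s.
Proof.
move=> st; split=> [H|e r].
  have := H _ (mem_head _ _); rewrite atom_event_count//= => c.
  apply: (@eq_from_nth _ None); rewrite size_mkseq c// => k kl.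
  rewrite nth_mkseq//; apply: (H (src_walk s k)).
  by rewrite in_cons; apply/orP; right; apply/mapP; exists k; rewrite ?mem_iota.
have c : start_count S n s o = size (lf s) by rewrite -e size_mkseq.
rewrite in_cons => /orP[/eqP ->|/mapP[k + ->]]; first by rewrite atom_event_count.
by rewrite mem_iota add0n /= => kl; rewrite -e nth_mkseq// c.
Qed.

Lemma atom_prob :
  Q [set o | forall s, s \in ss ->
       mkseq (walk_hit S n s ^~ o) (start_count S n s o) = lf s] =
  \prod_(s <- ss) list_weight (start_rate mu lam n s) (hit_law S s) (lf s).
Proof.
rewrite (_ : [set o | _] = [set o | forall r,
    r \in flatten [seq block s | s <- ss] -> atom_event r o]); last first.
  apply/seteqP; split => o /= H.
    move=> r /flatten_mapP[s sss rs].
    by have /block_occursP := H s sss; apply => //; exact: starts_ss.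
  move=> s sss; apply/block_occursP; first exact: starts_ss.
  by move=> r rs; apply: H; apply/flatten_mapP; exists s.
rewrite independent_sources ?uniq_blocks//; last first.
  move=> r /flatten_mapP[s /starts_ss st]; rewrite in_cons.
  move=> /orP[/eqP ->|/mapP[k _ ->]].
    split; first exact: count_source_present.
    by rewrite atom_event_count//; exact: count_source_event.
  by split; [exact: st|exact: walk_source_event].
rewrite big_flatten big_map big_seq [RHS]big_seq.
by apply: eq_bigr => s /starts_ss; exact: block_prob.
Qed.

End atoms.
End atom_probabilities.

(** * The exact formula *)

Section hit_prob_values.
Variables (R : realType) (d n : nat).

Lemma hit_prob_v (z : site d n) : (1 <= d)%N ->
  hit_prob R n z.1.+1 z.2 (spine n) = (d%:R + 1)^-1 * d%:R ^ (z.1.+1%:Z - n%:Z).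
Proof.
move=> d1; have zn := ltn_ord z.1.
rewrite /hit_prob /= size_neighbors_spine//; last by lia.
rewrite -natr1; congr (_ * _).
have -> : (z.1.+1%:Z - n%:Z = - (`|n%:Z - z.1.+1%:Z| + 1).-1%:Z)%R.
  by lia.
by rewrite exprnN.
Qed.

Lemma hit_prob_v' (z : site d n) :
  hit_prob R n z.1.+1 z.2 (spine n.+1) = d%:R ^ (z.1.+1%:Z - n%:Z - 1).
Proof.
rewrite /hit_prob /= size_neighbors_end invr1 mul1r.
have -> : (z.1.+1%:Z - n%:Z - 1 = - (`|n.+1%:Z - z.1.+1%:Z| + 1).-1%:Z)%R.
  by have := ltn_ord z.1; lia.
by rewrite exprnN.
Qed.

Lemma hit_prob_leaf (y z : site d n) : y != z ->
  hit_prob R n z.1.+1 z.2 (leaf_of y) = d%:R ^ (- `|y.1.+1%:Z - z.1.+1%:Z| - 1).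
Proof.
move=> yz; have yz' : leaf_of y == leaf_of z = false.
  by apply/negbTE; apply: contra yz => /eqP/leaf_of_inj ->.
rewrite /hit_prob /= yz' size_neighbors_leaf; last exact: ltn_ord.
rewrite invr1 mul1r.
have -> : (- `|y.1.+1%:Z - z.1.+1%:Z| - 1 = - (`|y.1.+1%:Z - z.1.+1%:Z| + 2).-1%:Z)%R.
  by lia.
by rewrite exprnN.
Qed.

Lemma sum_site (F : nat -> 'I_d.-1 -> R) :
  \sum_(1 <= x < n.+1) \sum_(j < d.-1) F x j = \sum_(z : site d n) F z.1.+1 z.2.
Proof. by rewrite big_add1 big_mkord pair_big. Qed.

End hit_prob_values.

Section exact_formula.
Variables (R : realType) (d : nat) (mu lam al : R) (disp : measure_display)
  (Omega : measurableType disp) (P : probability Omega R) (S : particle_system P d)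
  (n : nat) (a : nat -> 'I_d.-1 -> bool).
Hypotheses (hd : (2 <= d)%N) (hmu : 0 <= mu) (hlam : 0 <= lam).
Hypothesis hS : is_particle_system al mu (poisson_prob lam 0%N) S.
Hypothesis N_pos : (0 < P (N_is S n))%E.
Local Notation N := (N_is S n).
Local Notation Q := (cprob P ^~ N).
Local Notation nu := (restricted P (measurable_N S n)).
Local Notation ss := (awake_starts n a).

Definition hits_at (o : Omega) : seq (seq (option (site d n))) :=
  [seq mkseq (walk_hit S n s ^~ o) (start_count S n s o) | s <- ss].

Lemma hits_at_prob ls : size ls = size ss ->
  Q [set o | hits_at o = ls] =
  \prod_(x <- zip ss ls) list_weight (start_rate mu lam n x.1) (hit_law S x.1) x.2.
Proof.
move=> sz; pose lf s := nth [::] ls (index s ss).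
have uss : uniq ss by exact: awake_starts_uniq.
have lsE : ls = [seq lf s | s <- ss].
  apply: (@eq_from_nth _ [::]); first by rewrite size_map.
  move=> i il; rewrite sz in il; rewrite (nth_map (spine 0))//.
  by rewrite /lf index_uniq.
have -> : zip ss ls = [seq (s, lf s) | s <- ss].
  by rewrite lsE; elim: ss => //= s tl ->.
rewrite big_map /= -(atom_prob hd hmu hlam hS N_pos lf uss); last first.
  by move=> s; exact: starts_awake.
congr (cprob P _ _); apply/seteqP; split => o /=; rewrite lsE /hits_at.
  by move=> /eq_in_map.
by move=> h; apply/eq_in_map.
Qed.

Definition bad_event : set Omega :=
  [set o | exists u k, starts n u /\ bad_walk S n u k o].

Lemma measurable_bad_event : measurable bad_event.
Proof.
apply: measurable_set_ex => u; apply: measurable_set_ex => k.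
apply: measurable_set_and; first exact: measurable_cst_prop.
exact: measurable_bad_walk.
Qed.

Lemma bad_event_null : nu bad_event = 0%E.
Proof.
have m u k : measurable [set o | starts n u /\ bad_walk S n u k o].
  apply: measurable_set_and; first exact: measurable_cst_prop.
  exact: measurable_bad_walk.
apply: null_ex => u; first by apply: measurable_set_ex => k.
apply: null_ex => k; first exact: m.
by apply: null_and_cst => su; exact: (bad_walk_null hS N_pos k su).
Qed.

(** On [N], off the null event, the atoms of the list variable decide [A], so that
    each of them contributes all of its weight or nothing. *)
Lemma hits_event_prob (A : set Omega) (G : pred (seq (seq (option (site d n))))) :
  measurable (A `&` N) ->
  (forall o, N o -> ~ bad_event o -> A o <-> G (hits_at o)) ->
  P (A `&` N) = ((fine (P N))%:E *
    joint_mean (start_rate mu lam n) (hit_law S (n := n)) ss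
      (fun ls => ((G ls)%:R)%:E))%E.
Proof.
move=> mA AG.
have -> : P (A `&` N) = nu (A `&` N) by rewrite restrictedE -setIA setIid.
have m_at ls : measurable [set o | hits_at o = ls].
  rewrite /hits_at; elim: (ss) ls => [|s tl IH] ls.
    exact: (measurable_cst_prop ([::] = ls)).
  case: ls => [|l ls] /=.
    by rewrite (_ : [set o | _] = set0)//; apply/seteqP; split.
  pose L s' o := mkseq (walk_hit S n s' ^~ o) (start_count S n s' o).
  rewrite (_ : [set o | _] =
      [set o | L s o = l] `&` [set o | [seq L s' o | s' <- tl] = ls]).
    apply: measurableI => //; apply: measurable_mkseq.
      by move=> c; exact: measurable_start_count.
    by move=> k t; exact: measurable_walk_hit.
  by apply/seteqP; split => o /=; rewrite /L => -[-> ->].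
have mB := measurable_bad_event; have B0 := bad_event_null.
apply: (joint_mean_total (C := start_count S n) (V := walk_hit S n)) => //.
- by move=> s; exact: start_rate_ge0.
- by move=> s t; exact: cprob_ge0.
- by move=> s c; exact: measurable_start_count.
- by move=> s k t; exact: measurable_walk_hit.
- by rewrite fine_ge0.
move=> ls sz; rewrite -hits_at_prob// -(cprob_restr (measurable_N S n) N_pos (m_at ls)).
case Gls : (G ls).
  rewrite mulr1n mule1; apply: (eq_restr_null mB B0) => //; first exact: measurableI.
  move=> o No good /=; split=> [[]//|ho]; split=> //; split=> //.
  by apply/AG => //; rewrite ho.
rewrite mulr0n mule0; transitivity (nu set0); last exact: measure0.
apply: (eq_restr_null mB B0) => //; first exact: measurableI.
move=> o No good; split=> // -[[Ao _] ho].
have {}ho : hits_at o = ls := ho.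
by move/AG : Ao => /(_ No good); rewrite ho Gls.
Qed.

Let good_hit o u k z : ~ bad_event o -> starts n u ->
  (exists m, ps_walk S u k m.+1 o = leaf_of z) <-> walk_hit S n u k o = Some z.
Proof.
move=> good su; apply: (good_walk_hitP (S := S)).
by move=> b; apply: good; exists u, k.
Qed.

Let count_starts o u : (0 < start_count S n u o)%N -> starts n u.
Proof.
case: u => [k|y i] /=; last by case: ifP.
by case: (k == n) => //=; case: (k == n.+1).
Qed.

Lemma A_eq_prob : P (A_eq S n a `&` N) = ((fine (P N))%:E *
  joint_mean (start_rate mu lam n) (hit_law S (n := n)) ss
   (fun ls => ((all_wanted_reached a ls && all (all (allowed a)) ls)%:R)%:E))%E.
Proof.
apply: hits_event_prob.
  rewrite (_ : _ `&` _ = [set o | (forall y i, (1 <= y <= n)%N ->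
      `[< activated n (start_count S n ^~ o) (fun u k m => ps_walk S u k m o)
           (leaf y i) >] = a y i) /\ N o]); last first.
    apply/seteqP; split => o /= [H No]; split=> // y i yn; have := H y i yn;
    by rewrite /leaf_activated (ps_count_start No) No.
  apply: measurable_set_and; last exact: measurable_N.
  apply: measurable_set_all => y; apply: measurable_set_all => i.
  apply: measurable_set_imp; first exact: measurable_cst_prop.
  have mact := @measurable_activated _ _ d n (start_count S n)
    (fun u k m o => ps_walk S u k m o)
    (fun u c => measurable_start_count S n u c)
    (fun u k m v => measurable_rv_vertex (ps_walk S u k m) v) (leaf y i).
  case: (a y i).
    rewrite (_ : [set o | _] = [set o | activated n (start_count S n ^~ o)
      (fun u k m => ps_walk S u k m o) (leaf y i)])//.
    by apply/seteqP; split => o /= h; apply/asboolP.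
  rewrite (_ : [set o | _] = [set o | ~ activated n (start_count S n ^~ o)
      (fun u k m => ps_walk S u k m o) (leaf y i)]).
    exact: measurable_set_not.
  by apply/seteqP; split => o /= h; [move/negbT/asboolPn : h|apply/negbTE/asboolPn].
move=> o No good.
have hitP u k z := @good_hit o u k z good.
apply: iff_trans (activationP a (@count_starts o) hitP).
have Nn : ps_N S o = n := No.
rewrite /A_eq /leaf_activated /= (ps_count_start No) Nn; exact: iff_refl.
Qed.

Lemma A_event_prob : P (A_event S n a `&` N) = ((fine (P N))%:E *
  joint_mean (start_rate mu lam n) (hit_law S (n := n)) ss
   (fun ls => ((all_wanted_reached a ls)%:R)%:E))%E.
Proof.
apply: hits_event_prob.
  rewrite (_ : _ `&` _ = [set o | (forall y i, (1 <= y <= n)%N -> a y i ->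
      activated n (thin a (start_count S n ^~ o)) (fun u k m => ps_walk S u k m o)
           (leaf y i)) /\ N o]); last first.
    apply/seteqP; split => o /= [H No]; split=> // y i yn ay; have := H y i yn ay;
    by rewrite (ps_count_start No) No.
  apply: measurable_set_and; last exact: measurable_N.
  apply: measurable_set_all => y; apply: measurable_set_all => i.
  apply: measurable_set_imp; first exact: measurable_cst_prop.
  apply: measurable_set_imp; first exact: measurable_cst_prop.
  apply: (@measurable_activated _ _ d n (fun u o => thin a (start_count S n ^~ o) u)
    (fun u k m o => ps_walk S u k m o)).
    move=> [k|y' i'] c; first exact: (measurable_start_count S n (spine k) c).
    rewrite /thin; case: (a y' i'); first exact: measurable_start_count.
    exact: measurable_cst_prop.
  by move=> u k m v; exact: measurable_rv_vertex.
move=> o No good.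
have hitP u k z := @good_hit o u k z good.
apply: iff_trans (thinned_activationP a (@count_starts o) hitP).
have Nn : ps_N S o = n := No.
rewrite /A_event /= (ps_count_start No) Nn; exact: iff_refl.
Qed.

(** The mean number of particles that end at a site with [a = false]. *)
Definition absorption_rate : R :=
  \sum_(s <- ss) start_rate mu lam n s *
    \sum_(t : option (site d n) | ~~ allowed a t) hit_law S s t.

Lemma cprob_A_eq :
  Q (A_eq S n a) = expR (- absorption_rate) * Q (A_event S n a).
Proof.
have fe ls : ((all_wanted_reached a ls && all (all (allowed a)) ls)%:R)%:E =
    (if all (all (allowed a)) ls then (all_wanted_reached a ls)%:R%:E else 0%E)
    :> \bar R.
  by case: ifP => _; rewrite ?andbT ?andbF.
have H : P (A_event S n a `&` N) =
    ((expR absorption_rate)%:E * P (A_eq S n a `&` N))%E.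
  rewrite A_event_prob (joint_mean_thinning _ _ _ (u := allowed a)); first last.
  - by move=> ls; rewrite -all_wanted_reached_filter.
  - by move=> ls; rewrite lee_fin.
  - by move=> s t; exact: cprob_ge0.
  - by move=> s; exact: start_rate_ge0.
  rewrite A_eq_prob muleCA; congr (_ * (_ * _))%E.
  by apply: eq_joint_mean => ls; rewrite fe.
rewrite /cprob H; case: (P _) => [x||].
- by rewrite -EFinM /= mulrA mulrA -expRD addNr expR0 mul1r.
- by rewrite gt0_muley ?lte_fin ?expR_gt0//= !mul0r mulr0.
- by rewrite gt0_muleNy ?lte_fin ?expR_gt0//= !mul0r mulr0.
Qed.

Lemma sum_not_allowed s : starts n s ->
  \sum_(t : option (site d n) | ~~ allowed a t) hit_law S s t =
  \sum_(z : site d n | ~~ wanted a z) hit_prob R n z.1.+1 z.2 s.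
Proof.
move=> st; rewrite (reindex_omap Some id)/=; last by case.
under eq_bigl do rewrite eqxx andbT.
by apply: eq_bigr => z _; rewrite /hit_law (walk_hit_law hd hS N_pos).
Qed.

Lemma absorption_rateE :
  absorption_rate = \sum_(1 <= x < n.+1) \sum_(j < d.-1)
            (1 - (a x j)%:R) *
            (mu / (d%:R + 1) * d%:R ^ (x%:Z - n%:Z)
             + lam * d%:R ^ (x%:Z - n%:Z - 1)
             + lam * \sum_(1 <= y < n.+1) \sum_(i < d.-1)
                       (a y i)%:R * d%:R ^ (- `|y%:Z - x%:Z| - 1)).
Proof.
rewrite sum_site /absorption_rate.
under [RHS]eq_bigr do rewrite sum_site.
transitivity (\sum_(z : site d n | ~~ wanted a z)
   \sum_(s <- ss) start_rate mu lam n s * hit_prob R n z.1.+1 z.2 s).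
  rewrite exchange_big /=  big_seq [RHS]big_seq; apply: eq_bigr => s /starts_awake st.
  by rewrite sum_not_allowed// mulr_sumr.
rewrite big_mkcond /=; apply: eq_bigr => z _; rewrite -/(wanted a z).
case: (boolP (wanted a z)) => az /=; first by rewrite subrr mul0r.
rewrite subr0 mul1r !big_cons big_map big_filter big_enum_cond /=.
rewrite {1}/start_rate eqxx hit_prob_v; last exact: ltnW.
rewrite {1}/start_rate eq_spine gtn_eqF// hit_prob_v'.
rewrite addrA mulrA; congr (_ + _).
rewrite mulr_sumr big_mkcond /=; apply: eq_bigr => y _; rewrite -/(wanted a y).
case: (boolP (wanted a y)) => ay; last by rewrite mul0r mulr0.
rewrite mul1r /start_rate; case: eqP => // _; rewrite hit_prob_leaf//.
by apply: contraNneq az => <-.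
Qed.

End exact_formula.

Theorem lemma12 (R : realType) (d : nat) (hd : (2 <= d)%N)
    (mu lam : R) (hmu : 0 <= mu) (hlam : 0 <= lam)
    (tau : probability ext_nat R)
    (htau0 : tau [set Some 0%N] = 0%E) (htauoo : (tau [set None] < 1)%E)
    (disp : measure_display) (Omega : measurableType disp)
    (P : probability Omega R) (S : particle_system P d)
    (hS : is_particle_system (alpha d tau) mu (poisson_prob lam 0%N) S)
    (n : nat) (hn : (1 <= n)%N) (a : nat -> 'I_d.-1 -> bool) :
  cprob P (A_eq S n a) (N_is S n) =
  expR (- \sum_(1 <= x < n.+1) \sum_(j < d.-1)
            (1 - (a x j)%:R) *
            (mu / (d%:R + 1) * d%:R ^ (x%:Z - n%:Z)
             + lam * d%:R ^ (x%:Z - n%:Z - 1)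
             + lam * \sum_(1 <= y < n.+1) \sum_(i < d.-1)
                       (a y i)%:R * d%:R ^ (- `|y%:Z - x%:Z| - 1))) *
  cprob P (A_event S n a) (N_is S n).
Proof.
have [N0|N_pos] := eqVneq (P (N_is S n)) 0%E.
  (* division by zero makes both conditional probabilities vanish *)
  by rewrite /cprob N0 /= invr0 !mulr0.
have {}N_pos : (0 < P (N_is S n))%E by rewrite lt0e N_pos measure_ge0.
rewrite (cprob_A_eq a hd hmu hlam hS N_pos).
by rewrite (absorption_rateE a hd hS N_pos).
Qed.
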